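(* Let $M$ be a compact complex manifold of complex dimension $n$ and let $(E,h)\to M$ be a holomorphic vector bundle of rank $r$ with a Hermitian metric $h$ which is Bott-Chern nonnegative. Then for every $1\leq i\leq n$ and every $\lambda\in\Gamma(i,r)$ the closed real $(i,i)$-form $$S_{\lambda}\big(c_1(E,h),\ldots,c_r(E,h)\big)$$ is strongly nonnegative. In particular, the closed real $(i,i)$-forms $$c_i(E,h)\qquad(1\leq i\leq n)$$ and $$c_{i-j}(E,h)\,c_j(E,h)-c_{i-j+1}(E,h)\,c_{j-1}(E,h)\qquad\big(1\leq i\leq n,\ 1\leq j\leq[\tfrac{i}{2}]\big)$$ are strongly nonnegative.
   Context: Curvature and Chern forms: let $\nabla$ be the Chern connection of $(E,h)$ and $R=\nabla^2$ its curvature. For a local frame field $\{e_1,\ldots,e_r\}$ of $E$ write $R(e_1,\ldots,e_r)=(e_1,\ldots,e_r)(\Omega^i_j)$ ($i$ row, $j$ column); $\Omega=(\Omega^i_j)$ is the curvature matrix, whose entries are $2$-forms of type $(1,1)$. The Chern forms $c_i(E,h)$ are the globally defined closed real $(i,i)$-forms given by $\det\big(tI_r+\frac{\sqrt{-1}}{2\pi}(\Omega^i_j)\big)=\sum_{i=0}^{r}c_i(E,h)\,t^{r-i}$, with $c_0(E,h)=1$ and $c_i(E,h)=0$ for $i<0$ or $i>r$. Products of forms are wedge products. Bott-Chern nonnegativity: $(E,h)$ is Bott-Chern nonnegative (written $h\geq_{\mathrm{BC}}0$) if for any point of $M$ there exist a unitary frame field around it and a matrix $A$ with $r$ rows (and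 any number of columns, which may depend on the point) whose entries are $(1,0)$-forms, such that the curvature matrix under this unitary frame field satisfies $\Omega=A\wedge\overline{A^t}$. Schur polynomials: $\Gamma(i,r)$ is the set of $\lambda=(\lambda_1,\ldots,\lambda_i)$ of integers with $r\geq\lambda_1\geq\cdots\geq\lambda_i\geq0$ and $\sum_{j=1}^i\lambda_j=i$. For $\lambda\in\Gamma(i,r)$, $S_{\lambda}(c_1,\ldots,c_r):=\det(c_{\lambda_j-j+k})_{1\leq j,k\leq i}$ ($j$ row, $k$ column), with the convention $c_0=1$ and $c_j=0$ if $j<0$ or $j>r$. Strong nonnegativity: a real $(p,p)$-form $\varphi$ on $M$ is strongly nonnegative (written $\varphi\geq_{\mathrm{s}}0$) if at every point it can be written as a finite sum $\varphi=(\sqrt{-1})^{p^2}\sum_i\psi_i\wedge\overline{\psi_i}$, where the $\psi_i$ are $(p,0)$-forms. $[\cdot]$ denotes the integer part. *)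

(* Defs.v *)
From HB Require Import structures.
From mathcomp Require Import all_boot all_order all_algebra.

Set Implicit Arguments.
Unset Strict Implicit.
Unset Printing Implicit Defensive.

Import Order.TTheory GRing.Theory Num.Theory.

Local Open Scope ring_scope.

(** * The exterior algebra on generators e_0, ..., e_(m-1)

   [a S] is the coefficient of e_(s_1) /\ ... /\ e_(s_p), where
   S = {s_1 < ... < s_p}.  The ring product is the wedge product.  [ext] is an
   alias of [{ffun _}], so that the pointwise product is not inferred. *)

Definition ext (K : comNzRingType) (m : nat) : Type :=
  {ffun {set 'I_m} -> K}.

HB.instance Definition _ (K : comNzRingType) m := GRing.Lmodule.copy (ext K m)
  {ffun {set 'I_m} -> K^o}.

(* e_A /\ e_B = (-1) ^ (inversions A B) e_(A :|: B) for disjoint A and B. *)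
Definition inversions m (A B : {set 'I_m}) : nat :=
  #|[set u : 'I_m * 'I_m | [&& u.1 \in A, u.2 \in B & (u.2 < u.1)%N]]|.

Definition wedge (K : comNzRingType) m (a b : ext K m) : ext K m :=
  [ffun S : {set 'I_m} => \sum_(A : {set 'I_m} | A \subset S)
     (-1) ^+ inversions A (S :\: A) * (a A * b (S :\: A)) : K].

Definition ext1 (K : comNzRingType) m : ext K m :=
  [ffun S : {set 'I_m} => (S == set0)%:R : K].

Definition gen (K : comNzRingType) m (k : 'I_m) : ext K m :=
  [ffun S : {set 'I_m} => (S == [set k])%:R : K].

Section ExtRing.
Variables (K : comNzRingType) (m : nat).
Implicit Types (A B D S : {set 'I_m}) (a b c : ext K m).

Lemma ext_addE a b S : (a + b) S = a S + b S.
Proof. by rewrite ffunE. Qed.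

Lemma ext_scaleE (t : K) a S : (t *: a) S = t * a S.
Proof. by rewrite ffunE. Qed.

Lemma inversions0l B : inversions set0 B = 0%N.
Proof. by apply: eq_card0 => u; rewrite !inE. Qed.

Lemma inversions0r A : inversions A set0 = 0%N.
Proof. by apply: eq_card0 => u; rewrite !inE andbF. Qed.

Lemma inversionsUl A B D : [disjoint A & B] ->
  inversions (A :|: B) D = (inversions A D + inversions B D)%N.
Proof.
move=> dAB; rewrite /inversions -cardsUI [X in (_ + X)%N](_ : _ = 0%N) ?addn0.
  by apply: eq_card => u; rewrite !inE andb_orl.
apply: eq_card0 => u; rewrite !inE; apply/negP.
case/andP=> /and3P[uA _ _] /and3P[uB _ _].
by move: (disjointFr dAB uA); rewrite uB.
Qed.

Lemma inversionsUr A B D : [disjoint A & B] ->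
  inversions D (A :|: B) = (inversions D A + inversions D B)%N.
Proof.
move=> dAB; rewrite /inversions -cardsUI [X in (_ + X)%N](_ : _ = 0%N) ?addn0.
  by apply: eq_card => u; rewrite !inE andb_orl andb_orr.
apply: eq_card0 => u; rewrite !inE; apply/negP.
case/andP=> /and3P[_ uA _] /and3P[_ uB _].
by move: (disjointFr dAB uA); rewrite uB.
Qed.

Lemma setUD_sub A B : A \subset B -> A :|: (B :\: A) = B.
Proof.
move=> AB; apply/setP => x; rewrite !inE.
by have := subsetP AB x; case: (x \in A) => // /(_ isT) ->.
Qed.

Lemma wedgeA : associative (@wedge K m).
Proof.
move=> a b c; apply/ffunP => S; rewrite !ffunE.
transitivity (\sum_(A : {set 'I_m} | A \subset S)
    \sum_(B : {set 'I_m} | (B \subset S) && (A \subset B))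
    (-1) ^+ inversions A (S :\: A) * (a A *
      ((-1) ^+ inversions (B :\: A) (S :\: B) *
        (b (B :\: A) * c (S :\: B))))).
  apply: eq_bigr => A AS; rewrite ffunE !mulr_sumr.
  rewrite (reindex_onto (fun B => B :\: A) (fun D => A :|: D)) /=; last first.
    move=> D; rewrite subsetD => /andP[_ dDA].
    by rewrite setDUl setDv set0U; apply/setDidPl.
  apply: eq_big => B.
    rewrite subsetD; apply/andP/andP => [[/andP[BAS _] /eqP <-]|[BS AB]].
      rewrite subUset AS BAS subsetUl; split=> //.
    split.
      rewrite (subset_trans (subsetDl _ _) BS) /=.
      by rewrite -setI_eq0 setDE -setIA [~: A :&: A]setIC setICr setI0 eqxx.
    by apply/eqP; exact: setUD_sub.
  move=> /andP[_ /eqP eB].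
  have -> : (S :\: A) :\: (B :\: A) = S :\: B.
    apply/setP => x; rewrite !inE.
    have : x \in A -> x \in B by move=> xA; rewrite -eB inE xA.
    by case: (x \in A) => [/(_ isT) ->|_]; case: (x \in B); case: (x \in S).
  by [].
rewrite (exchange_big_dep (fun B => B \subset S)) /=; last first.
  by move=> A B _ /andP[].
apply: eq_bigr => B BS; rewrite ffunE mulr_suml mulr_sumr.
apply: eq_big => A.
  rewrite BS /= andb_idl// => AB; exact: subset_trans AB BS.
move=> /andP[AS /andP[_ AB]].
have eSA : S :\: A = (B :\: A) :|: (S :\: B).
  apply/setP => x; rewrite !inE.
  have := subsetP AB x; have := subsetP BS x.
  case: (x \in A); case: (x \in B); case: (x \in S) => // H1 H2;
    first [by have := H1 isT | by have := H2 isT].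
have dSB (T : {set 'I_m}) : T \subset B -> [disjoint T & S :\: B].
  move=> TB; rewrite -setI_eq0; apply/eqP/setP => x; rewrite !inE.
  by have := subsetP TB x; case: (x \in T) => // ->.
have dAB : [disjoint A & B :\: A].
  rewrite -setI_eq0; apply/eqP/setP => x; rewrite !inE.
  by case: (x \in A).
have eB : B = A :|: (B :\: A).
  exact/esym/setUD_sub.
have e1 : inversions A (S :\: A) =
    (inversions A (B :\: A) + inversions A (S :\: B))%N.
  by rewrite eSA inversionsUr// dSB// subsetDl.
have e2 : inversions B (S :\: B) =
    (inversions A (S :\: B) + inversions (B :\: A) (S :\: B))%N.
  by rewrite {1}eB inversionsUl.
rewrite e1 e2 !exprD.
move: ((-1) ^+ _) ((-1) ^+ _) ((-1) ^+ _) (a A) (b _) (c _) => u v w x y z.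
by rewrite -!mulrA (mulrCA w v) (mulrCA x u) (mulrCA w u).
Qed.

Lemma wedge1l : left_id (@ext1 K m) (@wedge K m).
Proof.
move=> a; apply/ffunP => S; rewrite ffunE (bigD1 set0) ?sub0set //=.
rewrite inversions0l expr0 mul1r !ffunE eqxx mul1r setD0 big1 ?addr0 // => A.
by case/andP=> _ /negPf A0; rewrite ffunE A0 mul0r mulr0.
Qed.

Lemma wedge1r : right_id (@ext1 K m) (@wedge K m).
Proof.
move=> a; apply/ffunP => S; rewrite ffunE (bigD1 S) //=.
rewrite setDv inversions0r expr0 mul1r !ffunE eqxx mulr1 big1 ?addr0 // => A.
case/andP=> AS nAS; rewrite ffunE; case: eqP => [/eqP|]; last by rewrite !mulr0.
by rewrite setD_eq0 => SA; case/eqP: nAS; apply/eqP; rewrite eqEsubset AS.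
Qed.

Lemma wedgeDl : left_distributive (@wedge K m) +%R.
Proof.
move=> a b c; apply/ffunP => S; rewrite !ffunE -big_split /=.
by apply: eq_bigr => A _; rewrite !ffunE mulrDl mulrDr.
Qed.

Lemma wedgeDr : right_distributive (@wedge K m) +%R.
Proof.
move=> a b c; apply/ffunP => S; rewrite !ffunE -big_split /=.
by apply: eq_bigr => A _; rewrite !ffunE !mulrDr.
Qed.

Lemma ext1_neq0 : ext1 K m != 0.
Proof.
by apply/eqP => /ffunP/(_ set0); rewrite !ffunE eqxx; apply/eqP/oner_neq0.
Qed.

HB.instance Definition _ := GRing.Zmodule_isNzRing.Build (ext K m)
  wedgeA wedge1l wedge1r wedgeDl wedgeDr ext1_neq0.

Lemma ext_scaleAl (t : K) a b : t *: (a * b) = t *: a * b.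
Proof.
apply/ffunP => S; rewrite ext_scaleE !ffunE mulr_sumr.
by apply: eq_bigr => A _; rewrite ext_scaleE mulrCA !mulrA.
Qed.

HB.instance Definition _ :=
  GRing.Lmodule_isLalgebra.Build K (ext K m) ext_scaleAl.

Lemma ext_scaleAr (t : K) a b : t *: (a * b) = a * (t *: b).
Proof.
apply/ffunP => S; rewrite ext_scaleE !ffunE mulr_sumr.
by apply: eq_bigr => A _; rewrite ext_scaleE mulrCA; congr (_ * _); rewrite mulrCA.
Qed.

HB.instance Definition _ :=
  GRing.Lalgebra_isAlgebra.Build K (ext K m) ext_scaleAr.

End ExtRing.

(* Products of matrices of forms, with [*m], are matrix products for the wedge
   product of entries; matrices of scalars act through [scalar_mx_ext]. *)
Definition scalar_mx_ext (K : comNzRingType) m r s (A : 'M[K]_(r, s)) :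
  'M[ext K m]_(r, s) := map_mx (in_alg (ext K m)) A.

(* For m = n + n, [lshift n k] is the index of dz_k and [rshift n k] that of its
   conjugate: e_S has type (hdeg S, ahdeg S). *)
Definition hdeg n (S : {set 'I_(n + n)}) : nat :=
  #|[set k : 'I_n | lshift n k \in S]|.

Definition ahdeg n (S : {set 'I_(n + n)}) : nat :=
  #|[set k : 'I_n | rshift n k \in S]|.

From mathcomp Require Import all_classical all_reals all_analysis.
From mathcomp Require Import complex.
Import numFieldNormedType.Exports.

Local Open Scope classical_set_scope.
Local Open Scope ring_scope.

(** * Calculus on C^n

   A point of C^n is the real vector (x_1, .., x_n, y_1, .., y_n), with
   z_k = x_k + i y_k, so that derivatives are those of a real normed space. *)

Section Calculus.
Variables (R : realType) (n : nat).
Local Notation C := R[i].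
Local Notation V := 'rV[R]_(n + n).
Local Notation Ext := (ext C (n + n)).

(* Index [lshift n k] stands for z_k, index [rshift n k] for its conjugate. *)
Definition zcoord (k : 'I_(n + n)) (x : V) : C :=
  match fintype.split k with
  | inl j => (x ord0 (lshift n j) +i* x ord0 (rshift n j))%C
  | inr j => (x ord0 (lshift n j) -i* x ord0 (rshift n j))%C
  end.

Definition rpartial (k : 'I_(n + n)) (u : V -> R) (x : V) : R :=
  'D_(delta_mx ord0 k) u x.

Definition rpartials (s : seq 'I_(n + n)) (u : V -> R) : V -> R :=
  foldr rpartial u s.

(* W is meant to be open. *)
Definition rsmooth_on (W : set V) (u : V -> R) : Prop :=
  forall (s : seq 'I_(n + n)) (x : V), W x ->
    {for x, continuous (rpartials s u)} /\
    forall k, derivable (rpartials s u) x (delta_mx ord0 k).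

Definition smooth_on (W : set V) (f : V -> C) : Prop :=
  rsmooth_on W (fun x => complex.Re (f x)) /\
  rsmooth_on W (fun x => complex.Im (f x)).

Definition partial (k : 'I_(n + n)) (f : V -> C) (x : V) : C :=
  (rpartial k (fun y => complex.Re (f y)) x +i*
   rpartial k (fun y => complex.Im (f y)) x)%C.

Definition dz (k : 'I_n) (f : V -> C) (x : V) : C :=
  2^-1 * (partial (lshift n k) f x - 'i%C * partial (rshift n k) f x).

Definition dzbar (k : 'I_n) (f : V -> C) (x : V) : C :=
  2^-1 * (partial (lshift n k) f x + 'i%C * partial (rshift n k) f x).

Definition holomorphic_on (W : set V) (f : V -> C) : Prop :=
  smooth_on W f /\ forall x, W x -> forall k, dzbar k f x = 0.

(* Complex-valued forms on an open set of C^n are functions to [Ext]; the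
   generators e_(lshift n k) and e_(rshift n k) are dz_k and its conjugate. *)
Definition coefwise (D : (V -> C) -> V -> C) (w : V -> Ext) (x : V) : Ext :=
  [ffun S : {set 'I_(n + n)} => D (fun y => w y S) x].

Definition dext (w : V -> Ext) (x : V) : Ext :=
  \sum_(k < n) (gen C (lshift n k) * coefwise (dz k) w x +
                gen C (rshift n k) * coefwise (dzbar k) w x).

Definition dmx r s (w : V -> 'M[Ext]_(r, s)) (x : V) : 'M[Ext]_(r, s) :=
  \matrix_(i, j) dext (fun y => w y i j) x.

Definition of_degree (p : nat) (a : Ext) : Prop :=
  forall S : {set 'I_(n + n)}, a S != 0 -> #|S| = p.

Definition of_type (p q : nat) (a : Ext) : Prop :=
  forall S : {set 'I_(n + n)}, a S != 0 -> hdeg S = p /\ ahdeg S = q.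

Definition bar_index (k : 'I_(n + n)) : 'I_(n + n) :=
  match fintype.split k with inl j => rshift n j | inr j => lshift n j end.

(* The sign reorders conj(dz_I /\ dzbar_J) = dzbar_I /\ dz_J
   = (-1) ^ (|I| |J|) dz_J /\ dzbar_I. *)
Definition conj_ext (a : Ext) : Ext :=
  [ffun S : {set 'I_(n + n)} =>
     (-1) ^+ (hdeg S * ahdeg S) * conjc (a (bar_index @^-1: S))].

(* F^* e_k = d(zcoord k \o F), extended multiplicatively; [enum S] is
   increasing. *)
Definition pullback (F : V -> V) (a : Ext) (x : V) : Ext :=
  \sum_(S : {set 'I_(n + n)})
    a S *: \prod_(k <- enum S) dext (fun y => (zcoord k (F y))%:A) x.

(* Strong nonnegativity of a form at a point. *)
Definition strongly_nonnegative (p : nat) (a : Ext) : Prop :=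
  exists (m : nat) (psi : 'I_m -> Ext),
    (forall i, of_type p 0 (psi i)) /\
    a = ('i%C ^+ (p ^ 2)) *: \sum_(i < m) psi i * conj_ext (psi i).

End Calculus.

(** * Complex manifolds *)

Record complexManifold (R : realType) (n : nat) := ComplexManifold {
  cm_space :> topologicalType;
  cm_hausdorff : hausdorff_space cm_space;
  chart : Type;
  cdom : chart -> set cm_space;
  cmap : chart -> cm_space -> 'rV[R]_(n + n);
  cinv : chart -> 'rV[R]_(n + n) -> cm_space;
  cdom_open : forall a, open (cdom a);
  cdom_cover : forall p, exists a, cdom a p;
  cran_open : forall a, open (cmap a @` cdom a);
  cmapK : forall a p, cdom a p -> cinv a (cmap a p) = p;
  cmap_continuous : forall a p, cdom a p -> {for p, continuous (cmap a)};
  cinv_continuous : forall a x, (cmap a @` cdom a) x ->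
    {for x, continuous (cinv a)};
  transition_holomorphic : forall a b (k : 'I_n),
    holomorphic_on (cmap a @` (cdom a `&` cdom b))
      (fun x => zcoord (lshift n k) (cmap b (cinv a x))) }.

Section Manifold.
Variables (R : realType) (n : nat) (M : complexManifold R n).
Local Notation C := R[i].
Local Notation V := 'rV[R]_(n + n).
Local Notation Ext := (ext C (n + n)).

Definition cimg (a : chart M) (U : set M) : set V :=
  cmap a @` (U `&` cdom a).

Definition smooth_fun (U : set M) (f : M -> C) : Prop :=
  forall a : chart M, smooth_on (cimg a U) (f \o cinv a).

Definition holomorphic_fun (U : set M) (f : M -> C) : Prop :=
  forall a : chart M, holomorphic_on (cimg a U) (f \o cinv a).

(* The local expressions of a form in all the charts. *)
Definition dform : Type := chart M -> V -> Ext.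

(* w is a differential form on U; no regularity of coefficients is asked. *)
Definition is_form (U : set M) (w : dform) : Prop :=
  forall (a b : chart M) (p : M), U p -> cdom a p -> cdom b p ->
    w a (cmap a p) =
    pullback (cmap b \o cinv a) (w b (cmap b p)) (cmap a p).

Definition strongly_nonnegative_on (U : set M) (p : nat) (w : dform) : Prop :=
  forall (a : chart M) (x : V), cimg a U x -> strongly_nonnegative p (w a x).

End Manifold.

(** * Holomorphic vector bundles

   A bundle is given by holomorphic frames e_b over the sets of an open cover;
   e_c = e_b (transit b c).  Frames are rows, components are columns. *)

Record holoBundle (R : realType) (n : nat) (M : complexManifold R n)
    (r : nat) := HoloBundle {
  triv : Type;
  tdom : triv -> set M;
  transit : triv -> triv -> M -> 'M[R[i]]_r;
  tdom_open : forall b, open (tdom b);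
  tdom_cover : forall p, exists b, tdom b p;
  transit_holomorphic : forall b c i j,
    holomorphic_fun (tdom b `&` tdom c) (fun p => transit b c p i j);
  transit_id : forall b p, tdom b p -> transit b b p = 1%:M;
  transit_cocycle : forall b c d p, tdom b p -> tdom c p -> tdom d p ->
    transit b c p *m transit c d p = transit b d p }.

(* [hmat b p i j] is h(e_i, e_j) for the frame e_b at p; h is linear in its
   first argument and antilinear in the second. *)
Record hermitianMetric (R : realType) (n : nat) (M : complexManifold R n)
    (r : nat) (E : holoBundle M r) := HermitianMetric {
  hmat : triv E -> M -> 'M[R[i]]_r;
  hmat_smooth : forall b i j, smooth_fun (tdom b) (fun p => hmat b p i j);
  hmat_herm : forall b p, tdom b p -> (hmat b p)^T = map_mx conjc (hmat b p);
  hmat_pos : forall b p (v : 'cV[R[i]]_r), tdom b p -> v != 0 ->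
    0 < (v^T *m hmat b p *m map_mx conjc v) ord0 ord0;
  hmat_transit : forall b c p, tdom b p -> tdom c p ->
    hmat c p = (transit b c p)^T *m hmat b p *m map_mx conjc (transit b c p) }.

(* The connection matrix theta of the frame e_b, in the chart a, is
   [cform b a]: nabla e_b = e_b theta. *)
Record connection (R : realType) (n : nat) (M : complexManifold R n)
    (r : nat) (E : holoBundle M r) := Connection {
  cform : triv E -> chart M -> 'rV[R]_(n + n) ->
    'M[ext R[i] (n + n)]_r;
  cform_degree : forall b a x i j, cimg a (tdom b) x ->
    of_degree 1 (cform b a x i j);
  cform_smooth : forall b a i j S,
    smooth_on (cimg a (tdom b)) (fun x => cform b a x i j S);
  cform_form : forall b i j, is_form (tdom b) (fun a x => cform b a x i j);
  cform_transit : forall b c a x, cimg a (tdom b `&` tdom c) x ->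
    let g y := scalar_mx_ext (n + n) (transit b c (cinv a y)) in
    g x *m cform c a x = dmx g x + cform b a x *m g x }.

Section Chern.
Variables (R : realType) (n : nat) (M : complexManifold R n) (r : nat).
Variable E : holoBundle M r.
Local Notation C := R[i].
Local Notation V := 'rV[R]_(n + n).
Local Notation Ext := (ext C (n + n)).
Implicit Types (h : hermitianMetric E) (D : connection E).

(* The connection acting on E-valued forms written e_b s, each column of s
   being one of them: nabla (e_b s) = e_b (ds + theta /\ s). *)
Definition nabla D (b : triv E) (a : chart M) s (w : V -> 'M[Ext]_(r, s)) :
  V -> 'M[Ext]_(r, s) := fun x => dmx w x + cform D b a x *m w x.

(* The Chern connection: its (0,1)-part is dbar, i.e. theta has type (1,0) in
   holomorphic frames, and dh(s, t) = h(nabla s, t) + h(s, nabla t). *)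
Definition chern_connection h D : Prop :=
  forall (b : triv E) (a : chart M) (x : V), cimg a (tdom b) x ->
    let H y := scalar_mx_ext (n + n) (hmat h b (cinv a y)) in
    (forall i j, of_type 1 0 (cform D b a x i j)) /\
    dmx H x = (cform D b a x)^T *m H x +
              H x *m map_mx (@conj_ext R n) (cform D b a x).

(* A frame field over U is given by its components: the frame is e_b (G b). *)
Definition unitary_frame h (U : set M) (G : triv E -> M -> 'M[C]_r) : Prop :=
  [/\ forall b i j, smooth_fun (U `&` tdom b) (fun p => G b p i j),
      forall b c p, U p -> tdom b p -> tdom c p ->
        G b p = transit b c p *m G c p
    & forall b p, U p -> tdom b p ->
        (G b p)^T *m hmat h b p *m map_mx conjc (G b p) = 1%:M].

(* The matrix Omega with nabla (nabla f) = f Omega, for the frame f = e_b g. *)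
Definition curvature_matrix D (b : triv E) (g : M -> 'M[C]_r) (a : chart M)
    (x : V) : 'M[Ext]_r :=
  scalar_mx_ext (n + n) (invmx (g (cinv a x))) *m
  nabla D b a (nabla D b a (fun y => scalar_mx_ext (n + n) (g (cinv a y)))) x.

(* The entries of A need not be smooth: this is the same as asking for a
   factorization at each point separately. *)
Definition bott_chern_nonnegative h D : Prop :=
  forall p : M, exists (U : set M) (G : triv E -> M -> 'M[C]_r) (s : nat)
      (A : chart M -> V -> 'M[Ext]_(r, s)),
    [/\ open U /\ U p,
        unitary_frame h U G,
        forall i j, is_form U (fun a x => A a x i j),
        forall a x i j, cimg a U x -> of_type 1 0 (A a x i j)
      & forall b a x, cimg a (U `&` tdom b) x ->
          curvature_matrix D b (G b) a x =
          A a x *m (map_mx (@conj_ext R n) (A a x))^T].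

(* c_m over tdom b, computed in the frame e_b, as the coefficient of t^(r-m) in
   det (t I + i/(2 pi) Omega).  The Leibniz formula [\det] makes sense over
   noncommutative rings; the entries here are of even degree, so commute. *)
Definition chern_form D (m : int) (b : triv E) : dform M := fun a x =>
  match m with
  | Posz k => if (k <= r)%N then
      (\det ('X%:M + map_mx (fun w : Ext => ((0 +i* (2 * pi)^-1)%C *: w)%:P)
         (curvature_matrix D b (fun=> 1%:M) a x)))`_(r - k)
    else 0
  | Negz _ => 0
  end.

(* The partitions Gamma(i, r). *)
Definition Gamma i (la : i.-tuple nat) : Prop :=
  [/\ all (fun k => (k <= r)%N) la, sorted geq la & sumn la = i].

Definition schur_form D i (la : i.-tuple nat) (b : triv E) : dform M :=
  fun a x => \det (\matrix_(j < i, k < i)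
    chern_form D ((tnth la j)%:Z - j%:Z + k%:Z) b a x).

End Chern.

(* Main.v *)
From HB Require Import structures.
From mathcomp Require Import all_boot all_order all_algebra.
From mathcomp Require Import all_fingroup mxrepresentation algC.
From mathcomp Require Import classfun character vcharacter.
From mathcomp Require Import zify.
Require Import Defs.

Set Implicit Arguments.
Unset Strict Implicit.
Unset Printing Implicit Defensive.

Import Order.TTheory GRing.Theory Num.Theory.

Local Open Scope ring_scope.

(** The statement is pointwise.  Fix a point, a chart and the holomorphic frame
   e_b.  For a frame e_b g with g smooth and invertible, Leibniz' rule and
   d (d g) = 0 (symmetry of second derivatives, [schwarz]) give
   nabla (nabla (e_b g)) = e_b (d theta + theta /\ theta) g
   ([curvature_commutes_with_scalars]); hence the curvature matrices in e_b and
   in the unitary frame are conjugate by an invertible matrix of scalars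
   ([curvature_frame_change]).  So up to conjugation the curvature matrix is
   Omega = A /\ conj(A)^T with A of type (1,0).  Its entries lie in the
   commutative ring of even forms, where determinants, hence Chern forms, are
   invariant under conjugation.

   Let la be a partition of k with l rows.  Expanding the determinant
   det (c_(la_j - j + j')) and every c_m into principal minors gives the
   Frobenius formula ([schur_determinant])

     k! S_la = (i / 2 pi)^k sum_(s in S_k) sgn(s) chi(s)
                 sum_(i : [k] -> [r]) prod_p Omega_(i p, i (s p)),

   where chi ([schur_character]) is an alternating sum of permutation
   characters of S_k.  Insert Omega_(i p, i q) = sum_a A_(i p, a) conj(A_(i q, a))
   and put Psi(i, a) = prod_p A_(i p, a p).  Moving the (0,1)-forms to the right
   costs the sign that turns i^k into i^(k^2); reordering them costs sgn(s),
   because they anticommute.  There remains, up to a positive constant,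

     i^(k^2) sum_(i, a) sum_s chi(s) Psi(i, a) conj(Psi(i, a o s^-1)).

   Now chi is an irreducible character, so that it is a positive multiple of the
   convolution chi * chi ([schur_character_convolution]); therefore the sum is a
   positive multiple of sum_(i, a) Psi'(i, a) conj(Psi'(i, a)), where Psi' is Psi
   averaged against chi ([schur_expansion_strongly_nonnegative]).

   That chi is irreducible is seen from its norm.  By Burnside's lemma, inner
   products of permutation characters on words count nonnegative integer matrices
   with given margins ([burnside_words]), and the alternating sums of these
   numbers that arise are computed by iterating Pieri's rule ([pieri],
   [signed_matrices_dominant]): chi has norm 1 and inner product 1 with a
   permutation character. *)

(** * Permutation characters and words *)

Section PermutationCharacter.
Variables (gT : finGroupType) (G : {group gT}) (X : finType).
Variables (to : {action gT &-> X}) (S : {set X}).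
Hypothesis GS : [acts G, on S | to].

(** The permutation representation on S is afforded by 0-1 matrices, whose trace
   counts fixed points. *)
Lemma permutation_character :
  exists2 chi : 'CF(G), chi \is a character
    & {in G, forall g, chi g = #|('Fix_(S | to)[g])%g|%:R}.
Proof.
have toS g (i : 'I_#|S|) : g \in G -> to (enum_val i) g \in S.
  by move=> Gg; rewrite (acts_act GS) // enum_valP.
pose M (g : gT) : 'M[algC]_#|S| :=
  \matrix_(i, j) (enum_val j == to (enum_val i) g)%:R.
have Mrepr : mx_repr G M.
  split.
    apply/matrixP => i j; rewrite !mxE act1 (inj_eq enum_val_inj).
    by rewrite eq_sym.
  move=> g h Gg Gh; apply/matrixP => i j; rewrite !mxE actM.
  rewrite (bigD1 (enum_rank_in (toS g i Gg) (to (enum_val i) g))) //=.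
  rewrite !mxE enum_rankK_in ?toS // eqxx mul1r big1 ?addr0 // => a na.
  rewrite !mxE; case: eqP => [ea|_]; last by rewrite mul0r.
  by case/eqP: na; apply: enum_val_inj; rewrite enum_rankK_in ?toS.
exists (cfRepr (MxRepresentation Mrepr)); first exact: cfRepr_char.
move=> g Gg; rewrite cfunE Gg mulr1n /mxtrace.
under eq_bigr do rewrite mxE.
rewrite -natr_sum; congr _%:R.
have -> : (\sum_(i < #|S|) (enum_val i == to (enum_val i) g) =
          \sum_(x in S) (x == to x g))%N.
  by rewrite [RHS]big_enum_val.
rewrite -big_mkcondr sum1dep_card; apply: eq_card => x.
by rewrite !inE sub1set inE eq_sym.
Qed.

End PermutationCharacter.

Section Words.
Variables (k : nat) (T : finType).
Implicit Types (f : {ffun 'I_k -> T}) (s : 'S_k).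

Definition word_count f (x : T) : nat := #|[set p | f p == x]|.

(** Permutations compose from left to right, so precomposition with the inverse is
   a right action. *)
Definition word_act f s : {ffun 'I_k -> T} := [ffun p => f ((s^-1)%g p)].

Lemma word_act_is_action : is_action [set: 'S_k] word_act.
Proof.
apply: is_total_action => [f|f s t]; apply/ffunP => p.
  by rewrite ffunE invg1 perm1.
by rewrite !ffunE invMg permM.
Qed.

Definition word_action := Action word_act_is_action.

Lemma word_count_act f s : word_count (word_act f s) =1 word_count f.
Proof.
move=> x; rewrite /word_count -[RHS](card_imset _ (@perm_inj _ s)).
apply: eq_card => p; rewrite !inE ffunE.
apply/eqP/imsetP => [<-|[q]]; last by rewrite inE => /eqP <- ->; rewrite permK.
by exists ((s^-1)%g p); rewrite ?inE ?permKV.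
Qed.

Lemma word_countE f x : word_count f x = count_mem x [tuple f p | p < k].
Proof.
rewrite /word_count cardE /= /image_mem count_map -size_filter.
congr size; rewrite [in LHS]/enum_mem -enumT; apply: eq_filter => p.
by rewrite !inE.
Qed.

Lemma sum_word_count f : (\sum_x word_count f x)%N = k.
Proof.
rewrite -[RHS]card_ord -sum1_card (partition_big f predT) //=.
apply: eq_bigr => x _; rewrite sum1dep_card; apply: eq_card => p.
by rewrite !inE.
Qed.

(** Words with the same letter counts are rearrangements of each other. *)
Lemma word_count_inj_orbit f g :
  word_count f =1 word_count g -> exists s, g = word_act f s.
Proof.
move=> e; have : perm_eq [tuple g p | p < k] [tuple f p | p < k].
  by apply/allP => x _; apply/eqP; rewrite -!word_countE e.
move=> /tuple_permP[s es]; exists (s^-1)%g; apply/ffunP => p.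
rewrite ffunE invgK.
have -> : g p = tnth [tuple g p | p < k] p by rewrite tnth_mktuple.
rewrite (_ : [tuple g p | p < k] =
    [tuple tnth [tuple f p | p < k] (s i) | i < k]) ?tnth_mktuple //.
exact: val_inj.
Qed.

Lemma word_of_count (m : T -> nat) : (\sum_x m x)%N = k ->
  exists f, word_count f =1 m.
Proof.
move=> mk; pose w := flatten [seq nseq (m x) x | x <- enum T].
have sw : size w == k.
  rewrite size_flatten /shape -map_comp sumnE big_map -mk big_enum /=.
  by apply/eqP; apply: eq_bigr => x _; rewrite /= size_nseq.
exists [ffun p => tnth (Tuple sw) p] => x; rewrite word_countE.
rewrite (_ : tval _ = w); last first.
  rewrite -[RHS]/(tval (Tuple sw)); congr tval; apply: eq_from_tnth => p.
  by rewrite tnth_mktuple ffunE.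
rewrite /w count_flatten -map_comp sumnE big_map big_enum /=.
rewrite (bigD1 x) //= count_nseq /= eqxx mul1n big1 ?addn0 // => y yx.
by rewrite count_nseq /= (negPf yx).
Qed.

Variable C : nat.
Hypothesis kC : (k <= C)%N.

(** The letter counts as an element of a finite type, so that letter counts can
   themselves be enumerated. *)
Definition bounded_count f : {ffun T -> 'I_C.+1} :=
  [ffun x => inord (word_count f x)].

Lemma bounded_countE f x : bounded_count f x = word_count f x :> nat.
Proof.
rewrite ffunE inordK // ltnS (leq_trans _ kC) //.
by rewrite -[X in (_ <= X)%N]card_ord max_card.
Qed.

(** Burnside's lemma: letter counts classify the orbits of words under
   rearrangement, so the right-hand side is the number of orbits times the order
   of the symmetric group. *)
Lemma burnside_words (Q : pred {ffun T -> 'I_C.+1}) :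
  (\sum_(s : 'S_k) #|[set f | Q (bounded_count f) & word_act f s == f]| =
   #|[set m | Q m & (\sum_x m x)%N == k]| * k`!)%N.
Proof.
pose S := [set f | Q (bounded_count f)].
have bca f s : bounded_count (word_act f s) = bounded_count f.
  by apply/ffunP => x; apply: val_inj; rewrite /= !bounded_countE word_count_act.
have GS : [acts [set: 'S_k], on S | word_action].
  apply/subsetP => s _; rewrite !inE /=; apply/subsetP => f.
  by rewrite !inE bca.
have := Frobenius_Cauchy GS.
rewrite (_ : #|[set: 'S_k]| = k`!); last by rewrite cardsT card_Sn.
rewrite (_ : #|orbit word_action [set: 'S_k] @: S| = #|bounded_count @: S|).
  rewrite (_ : bounded_count @: S = [set m | Q m & (\sum_x m x)%N == k]).
    move=> <-; apply: eq_big => [s|s _]; first by rewrite inE.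
    by apply: eq_card => f; rewrite !inE sub1set inE.
  apply/setP => m; rewrite inE; apply/imsetP/andP => [[f]|[Qm /eqP mk]].
    rewrite inE => Qf ->; split=> //; apply/eqP.
    under eq_bigr do rewrite bounded_countE.
    exact: sum_word_count.
  have [f fm] := word_of_count mk; exists f.
    rewrite inE (_ : bounded_count f = m) //.
    by apply/ffunP => x; apply: val_inj; rewrite /= bounded_countE fm.
  by apply/ffunP => x; apply: val_inj; rewrite /= bounded_countE fm.
have -> : bounded_count @: S =
    (fun O : {set {ffun 'I_k -> T}} =>
       odflt [ffun=> ord0] (omap bounded_count [pick f in O])) @:
      (orbit word_action [set: 'S_k] @: S).
  rewrite -imset_comp; apply: eq_imset => f /=.
  case: pickP => [g /orbitP[s _ <-] /=|/(_ f)]; first by rewrite bca.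
  by rewrite orbit_refl.
rewrite [RHS]card_in_imset //.
move=> _ _ /imsetP[f _ ->] /imsetP[g _ ->].
have rep h : odflt [ffun=> ord0] (omap bounded_count
     [pick f in orbit word_action [set: 'S_k] h]) = bounded_count h.
  case: pickP => [g' /orbitP[s _ <-] /=|/(_ h)]; first by rewrite bca.
  by rewrite orbit_refl.
rewrite !rep => e; have [x|s ->] := @word_count_inj_orbit f g.
  by rewrite -!bounded_countE e.
apply/eqP; rewrite orbit_eq_mem; apply/orbitP; exists (s^-1)%g; rewrite ?inE //.
exact: (actK word_action).
Qed.

End Words.

(** * Pieri's rule and signed counts of integer matrices *)

Section Pieri.
Variables (l C : nat).
Local Notation Y := {ffun 'I_l -> 'I_C.+1}.
Implicit Types (mu nu kappa : Y) (s t : 'S_l) (i j : 'I_l).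

Definition weight mu : nat := (\sum_j (mu j : nat))%N.
Definition dominated mu kappa : bool := [forall j, (mu j <= kappa j)%N].
Definition permute mu s : Y := [ffun j => mu (s j)].
Definition decreasing kappa : Prop :=
  forall i j, (i < j)%N -> (kappa j < kappa i)%N.

Lemma weight_permute mu s : weight (permute mu s) = weight mu.
Proof.
rewrite /weight [RHS](reindex_inj (@perm_inj _ s)) /=.
by apply: eq_bigr => j _; rewrite ffunE.
Qed.

(** For strictly decreasing exponents, which are partitions shifted by the
   staircase, [interlaced mu kappa] with [dominated mu kappa] says that kappa / mu
   is a horizontal strip. *)
Definition violates kappa mu i : bool :=
  [exists j : 'I_l, (j == i.+1 :> nat) && (mu i <= kappa j)%N].

Definition interlaced mu kappa : bool := [forall i, ~~ violates kappa mu i].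

(** Pieri's rule for the coefficients G of an alternating polynomial: multiplying
   by a complete symmetric function sums G over all smaller exponents, and the
   non-interlaced ones cancel.  The sign-reversing involution swaps mu_i and
   mu_(i+1) at the first index i where interlacing fails.  The proof discards the
   failures at one index after the other. *)
Lemma pieri (G : Y -> int) kappa (P : pred nat) :
    decreasing kappa ->
    (forall mu s, G (permute mu s) = (-1) ^+ s * G mu) ->
  \sum_(mu | dominated mu kappa && P (weight mu)) G mu =
  \sum_(mu | [&& dominated mu kappa, P (weight mu) & interlaced mu kappa]) G mu.
Proof.
move=> dk altG.
pose good n mu := [forall i : 'I_l, (i < n)%N ==> ~~ violates kappa mu i].
pose base n mu := [&& dominated mu kappa, P (weight mu) & good n mu].
suff step n : (n <= l)%N ->
    \sum_(mu | dominated mu kappa && P (weight mu)) G mu =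
    \sum_(mu | base n mu) G mu.
  rewrite (step l) //; apply: eq_bigl => mu; rewrite /base; do 2 congr andb.
  by apply: eq_forallb => i; rewrite ltn_ord.
elim: n => [_|n IHn nl].
  apply: eq_bigl => mu; rewrite /base; case: dominated => //=.
  by rewrite (_ : good 0%N mu) ?andbT //; apply/forallP.
rewrite IHn ?(ltnW nl) // (bigID (fun mu => violates kappa mu (Ordinal nl))) /=.
rewrite [X in X + _](_ : _ = 0) ?add0r.
  apply: eq_bigl => mu; rewrite /base -!andbA; do 2 congr andb.
  apply/andP/forallP => [[/forallP gn nv] i|gn].
    rewrite ltnS leq_eqVlt; apply/implyP => /orP[/eqP ein|lin].
      by rewrite (_ : i = Ordinal nl) //; apply: val_inj.
    by have /implyP := gn i; apply.
  split; last by have /implyP := gn (Ordinal nl); apply => /=.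
  by apply/forallP => i; apply/implyP => lin; have /implyP := gn i; apply; apply: ltnW.
set i := Ordinal nl.
have [Hj|nj] := boolP (n.+1 < l)%N; last first.
  rewrite big_pred0 // => mu; apply/negP => /andP[_ /existsP[j /andP[/eqP ej _]]].
  by case/negP: nj; rewrite -[X in (X < _)%N](_ : j = n.+1 :> nat) ?ltn_ord.
set j := Ordinal Hj; pose sw mu := permute mu (tperm i j).
have swK : involutive sw.
  by move=> mu; apply/ffunP => a; rewrite !ffunE tpermK.
have ij : i != j by rewrite -val_eqE /= neq_ltn ltnSn.
have viol mu : violates kappa mu i = (mu i <= kappa j)%N.
  apply/existsP/idP => [[j' /andP[/eqP ej]]|h]; last by exists j; rewrite eqxx.
  by rewrite (_ : j' = j) //; apply: val_inj.
have inv mu : base n mu && violates kappa mu i ->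
              base n (sw mu) && violates kappa (sw mu) i.
  rewrite !viol => /andP[/and3P[/forallP dmu wmu /forallP gmu] vmu].
  rewrite /base weight_permute wmu ffunE tpermL dmu !andbT /=; apply/andP; split.
    apply/forallP => a; rewrite ffunE; case: tpermP => [->|->|_ _] //.
    by rewrite (leq_trans (dmu j)) // ltnW // dk /=.
  apply/forallP => a; apply/implyP => an; have /implyP/(_ an) := gmu a.
  apply: contra => /existsP[b /andP[eb]]; rewrite ffunE tpermD; last first.
  - by rewrite -val_eqE /= neq_ltn (ltn_trans an) ?orbT.
  - by rewrite -val_eqE /= neq_ltn an orbT.
  by move=> h; apply/existsP; exists b; rewrite eb.
have : \sum_(mu | base n mu && violates kappa mu i) G mu =
     - \sum_(mu | base n mu && violates kappa mu i) G mu.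
  rewrite [LHS](reindex_inj (inv_inj swK)) -sumrN; apply: eq_big => mu.
    by apply/idP/idP => [/inv|/inv //]; rewrite swK.
  by rewrite altG odd_tperm ij expr1 mulN1r.
by move/eqP; rewrite -addr_eq0 -mulr2n mulrn_eq0 => /eqP.
Qed.

End Pieri.

Section SignedMatrices.
Variables (l C : nat) (beta : nat -> nat).
Local Notation Y := {ffun 'I_l -> 'I_C.+1}.
Implicit Types (mu nu kappa : Y) (s t : 'S_l) (i j : 'I_l).

(** The exponents of the leading term of the Vandermonde determinant. *)
Definition staircase (j : 'I_l) : nat := (l - j.+1)%N.

(** Row sums are beta; column sums are kappa minus a permuted staircase, written
   without subtraction. *)
Definition matrix_ok n (m : {ffun 'I_n -> Y}) t kappa : bool :=
  [forall i, weight (m i) == beta i] &&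
  [forall j, (\sum_i (m i j : nat) + staircase (t j))%N == kappa j].

(** The coefficient of x^kappa in the Vandermonde alternant times
   h_(beta 0) ... h_(beta (n - 1)): row i of m is the exponent of the monomial
   taken from h_(beta i).  When kappa is a partition plus the staircase, this is
   a Kostka number. *)
Definition signed_matrices n kappa : int :=
  \sum_(t : 'S_l) (-1) ^+ t * #|[set m | @matrix_ok n m t kappa]|%:Z.

Lemma signed_matrices_permute n kappa s :
  signed_matrices n (permute kappa s) = (-1) ^+ s * signed_matrices n kappa.
Proof.
rewrite /signed_matrices mulr_sumr (reindex_inj (mulgI s)) /=.
apply: eq_bigr => t _; rewrite odd_permM signr_addb -mulrA; congr (_ * (_ * _%:Z)).
rewrite -[RHS](card_imset _
  (f := fun m : {ffun 'I_n -> Y} => [ffun i => permute (m i) s])).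
  apply: eq_card => m; rewrite inE; apply/idP/imsetP.
    move=> /andP[/forallP rm /forallP cm].
    exists [ffun i => permute (m i) s^-1]; last first.
      by apply/ffunP => i; apply/ffunP => j; rewrite !ffunE permK.
    rewrite inE; apply/andP; split; apply/forallP => i.
      by rewrite ffunE weight_permute.
    have := cm ((s^-1)%g i); rewrite !ffunE permM permKV => /eqP <-.
    by apply/eqP; congr addn; apply: eq_bigr => a _; rewrite !ffunE.
  case=> m'; rewrite inE => /andP[/forallP rm /forallP cm] ->.
  apply/andP; split; apply/forallP => i; first by rewrite ffunE weight_permute.
  rewrite ffunE permM -(eqP (cm (s i))); apply/eqP; congr addn.
  by apply: eq_bigr => a _; rewrite !ffunE.
move=> m m' e; apply/ffunP => i; apply/ffunP => j.
by have /ffunP/(_ i)/ffunP/(_ ((s^-1)%g j)) := e; rewrite !ffunE permKV.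
Qed.

Definition add_row n (m : {ffun 'I_n -> Y}) mu : {ffun 'I_n.+1 -> Y} :=
  [ffun i => oapp m mu (unlift ord_max i)].

Lemma add_row_bij n :
  bijective (fun p : {ffun 'I_n -> Y} * Y => add_row p.1 p.2).
Proof.
pose g (m : {ffun 'I_n.+1 -> Y}) : {ffun 'I_n -> Y} * Y :=
  ([ffun i => m (lift ord_max i)], m ord_max).
exists g; rewrite /g.
  move=> [m mu] /=; congr pair; last by rewrite ffunE unlift_none.
  by apply/ffunP => i; rewrite !ffunE liftK.
move=> m; apply/ffunP => i; rewrite !ffunE /=.
by case: unliftP => [a ->|->] /=; rewrite ?ffunE.
Qed.

Lemma matrix_ok_add_row n (m : {ffun 'I_n -> Y}) mu t kappa :
  matrix_ok (add_row m mu) t kappa =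
  [&& [forall i, weight (m i) == beta i], weight mu == beta n &
      [forall j, (\sum_i (m i j : nat) + staircase (t j) + mu j)%N == kappa j]].
Proof.
have ar0 : add_row m mu ord_max = mu by rewrite ffunE unlift_none.
have arS (i : 'I_n) : add_row m mu (widen_ord (leqnSn n) i) = m i.
  rewrite ffunE (_ : widen_ord _ _ = lift ord_max i) ?liftK //.
  by apply: val_inj; rewrite /= /bump leqNgt ltn_ord.
rewrite /matrix_ok andbA; congr andb.
  apply/forallP/andP => [h|[/forallP h1 h2] i].
    split; last by have := h ord_max; rewrite ar0.
    by apply/forallP => i; have := h (widen_ord (leqnSn n) i); rewrite arS.
  have [lin|] := ltnP i n.
    rewrite (_ : i = widen_ord (leqnSn n) (Ordinal lin)) ?arS ?h1 //.
    exact: val_inj.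
  move=> nin; rewrite (_ : i = ord_max) ?ar0 //.
  by apply: val_inj; apply/eqP; rewrite eqn_leq nin -ltnS ltn_ord.
apply: eq_forallb => j; rewrite big_ord_recr /= ar0 addnAC.
by under eq_bigr do rewrite arS.
Qed.

(** The exponent mu is what remains of kappa once the last row is removed. *)
Lemma signed_matrices_rec n kappa :
  signed_matrices n.+1 kappa =
  \sum_(mu | dominated mu kappa && (weight mu + beta n == weight kappa)%N)
    signed_matrices n mu.
Proof.
rewrite exchange_big; apply: eq_bigr => t _ /=; rewrite -mulr_sumr.
congr (_ * _); rewrite -(big_morph Posz PoszD (erefl _)); congr Posz.
have cE k (A : pred {ffun 'I_k -> Y}) :
    #|[set m | A m]| = (\sum_(m | A m) 1)%N by rewrite sum1dep_card.
rewrite cE; under [RHS]eq_bigr do rewrite cE.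
have [g gK Kg] := add_row_bij n.
rewrite (reindex (fun p : {ffun 'I_n -> Y} * Y => add_row p.1 p.2)); last first.
  by exists g => x _; [apply: gK | apply: Kg].
rewrite -[LHS](pair_big_dep predT (fun m mu => matrix_ok (add_row m mu) t kappa)
   (fun _ _ => 1%N)) /=.
rewrite [RHS](exchange_big_dep predT) //=; apply: eq_bigr => m _.
pose co mu : Y := [ffun j => inord (kappa j - mu j)].
have coE mu j : co mu j = (kappa j - mu j)%N :> nat.
  by rewrite ffunE inordK // ltnS (leq_trans (leq_subr _ _)) // -ltnS.
have coK mu : (co (co mu) == mu) = dominated mu kappa.
  apply/eqP/forallP => [<- j|h]; first by rewrite coE leq_subr.
  by apply/ffunP => j; apply: val_inj; rewrite /= !coE subKn.
have wco mu : dominated mu kappa -> (weight (co mu) + weight mu)%N = weight kappa.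
  move=> /forallP h; rewrite /weight -big_split; apply: eq_bigr => j _ /=.
  by rewrite coE subnK.
rewrite (reindex_onto co co) /=; last first.
  move=> mu; rewrite matrix_ok_add_row => /and3P[_ _ /forallP h].
  by apply/eqP; rewrite coK; apply/forallP => j; rewrite -(eqP (h j)) leq_addl.
apply: eq_bigl => mu; rewrite coK matrix_ok_add_row.
have [dmu|] := boolP (dominated mu kappa); last by rewrite andbF.
have -> : (weight (co mu) == beta n) = (weight mu + beta n == weight kappa)%N.
  by rewrite -(wco _ dmu) addnC eqn_add2r eq_sym.
rewrite andbT /matrix_ok andbCA; congr andb; congr andb.
apply: eq_forallb => j; rewrite coE; have /forallP/(_ j) := dmu.
by move: (\sum_i _)%N => a; lia.
Qed.


Lemma signed_matrices_pieri n kappa : decreasing kappa ->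
  signed_matrices n.+1 kappa =
  \sum_(mu | [&& dominated mu kappa, (weight mu + beta n == weight kappa)%N
             & interlaced mu kappa]) signed_matrices n mu.
Proof.
move=> dk; rewrite signed_matrices_rec.
apply: (pieri (fun w => w + beta n == weight kappa)%N) => // mu s.
exact: signed_matrices_permute.
Qed.

Lemma interlaced_decreasing mu kappa : decreasing kappa ->
  dominated mu kappa -> interlaced mu kappa -> decreasing mu.
Proof.
move=> dk /forallP dmu /forallP imu i j ij.
have lil : (i.+1 < l)%N by rewrite (leq_ltn_trans ij).
have := imu i; rewrite negb_exists => /forallP/(_ (Ordinal lil)).
rewrite eqxx /= -ltnNge; apply: leq_ltn_trans.
rewrite (leq_trans (dmu j)) //.
have [<-|ne] := eqVneq (Ordinal lil) j; first by [].
by rewrite ltnW // dk // ltn_neqAle ij andbT.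
Qed.

Lemma signed_matrices_weight n kappa : signed_matrices n kappa != 0 ->
  weight kappa = (\sum_(i < n) beta i + \sum_j staircase j)%N.
Proof.
move=> nz; have [t /set0Pn[m]] : exists t, [set m | @matrix_ok n m t kappa] != finset.set0.
  apply/existsP; apply: contraNT nz; rewrite negb_exists => /forallP h.
  rewrite /signed_matrices big1 // => t _.
  by have := h t; rewrite negbK => /eqP ->; rewrite cards0 mulr0.
rewrite inE => /andP[/forallP rm /forallP cm].
rewrite /weight; under eq_bigr => j _ do rewrite -(eqP (cm j)).
rewrite big_split exchange_big /=; congr addn.
  by apply: eq_bigr => i _; rewrite -(eqP (rm i)).
by rewrite [RHS](reindex_inj (@perm_inj _ t)).
Qed.

Lemma staircase_lt i j : (staircase i < staircase j)%N = (j < i)%N.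
Proof. by rewrite /staircase; have := ltn_ord i; have := ltn_ord j; lia. Qed.

Lemma staircase_le i j : (staircase i <= staircase j)%N = (j <= i)%N.
Proof. by rewrite leqNgt staircase_lt -leqNgt. Qed.

Lemma increasing_perm1 s : (forall i j, (i < j)%N -> (s i < s j)%N) -> s = 1%g.
Proof.
have ge (u : 'S_l) : (forall i j, (i < j)%N -> (u i < u j)%N) ->
    forall i, (i <= u i)%N.
  move=> ui [n]; elim: n => // n IHn nl.
  by rewrite (leq_ltn_trans (IHn (ltnW nl))) // ui.
move=> si; apply/permP => i; rewrite perm1; apply: val_inj; apply/eqP.
rewrite eqn_leq ge // andbT; have := ge (s^-1)%g _ (s i).
rewrite permK; apply=> a b ab.
rewrite ltnNge; apply: contraL ab; rewrite -leqNgt leq_eqVlt => /orP[/eqP|/si].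
  by move/val_inj/perm_inj ->.
by rewrite !permKV => /ltnW.
Qed.

Lemma signed_matrices0 kappa : decreasing kappa ->
  signed_matrices 0 kappa = [forall j, kappa j == staircase j :> nat].
Proof.
move=> dk; pose flat := [forall j, kappa j == staircase j :> nat].
have okE m t : @matrix_ok 0 m t kappa = (t == 1%g) && flat.
  rewrite /matrix_ok (_ : [forall i, _]) /=; last by apply/forallP => -[].
  apply/forallP/andP => [h|[/eqP -> /forallP h] j]; last first.
    by rewrite big_ord0 perm1 eq_sym h.
  have kt j : kappa j = staircase (t j) :> nat.
    by rewrite -(eqP (h j)) big_ord0.
  have t1 : t = 1%g.
    by apply: increasing_perm1 => i j /dk; rewrite !kt staircase_lt.
  by rewrite t1 eqxx; split=> //; apply/forallP => j; rewrite kt t1 perm1.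
have cE t : #|[set m | @matrix_ok 0 m t kappa]| = ((t == 1%g) && flat) :> nat.
  rewrite (eq_card (B := [pred m | (t == 1%g) && flat])); last first.
    by move=> m; rewrite !inE okE.
  case: (_ && _); last exact: eq_card0.
  by rewrite (eq_card (B := predT)) // card_ffun !card_ord expn0.
rewrite /signed_matrices (bigD1 1%g) //= cE odd_perm1 eqxx mul1r big1 ?addr0 //.
by move=> t /negPf nt; rewrite cE nt mulr0.
Qed.

(** A product of n complete symmetric functions only involves partitions with at
   most n rows: adding a horizontal strip creates at most one new row. *)
Lemma signed_matrices_tail n kappa : decreasing kappa ->
  signed_matrices n kappa != 0 ->
  forall j, (n <= j)%N -> kappa j = staircase j :> nat.
Proof.
elim: n kappa => [|n IHn] kappa dk.
  rewrite signed_matrices0 //; case: forallP => // h _ j _.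
  exact/eqP.
rewrite signed_matrices_pieri // => nz j nj.
have [mu /and3P[dmu wmu imu] mu0] : exists2 mu, 
    [&& dominated mu kappa, (weight mu + beta n == weight kappa)%N
      & interlaced mu kappa] & signed_matrices n mu != 0.
  apply/exists_inP; apply: contraNT nz => /exists_inPn h.
  by rewrite big1 // => mu /h; rewrite negbK => /eqP.
have tl := IHn _ (interlaced_decreasing dk dmu imu) mu0.
have [i ej] : exists i : 'I_l, j = i.+1 :> nat.
  have j1l : (j.-1 < l)%N by rewrite (leq_ltn_trans (leq_pred _)).
  by exists (Ordinal j1l); rewrite /= (ltn_predK nj).
have /forallP/(_ i) := imu.
rewrite negb_exists => /forallP/(_ j); rewrite ej eqxx /= -ltnNge.
have ni : (n <= i)%N by rewrite -ltnS -ej.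
have /forallP/(_ j) := dmu; rewrite (tl j (ltnW nj)) (tl i ni) /staircase ej.
by have := ltn_ord j; rewrite ej; lia.
Qed.

Lemma decreasing_staircase kappa : decreasing kappa ->
  forall j, (staircase j <= kappa j)%N.
Proof.
move=> dk j; rewrite /staircase.
have [n] := ubnP (l - j.+1)%N; elim: n j => // n IHn j jn.
have [jl|nj] := ltnP j.+1 l; last by rewrite (_ : (l - j.+1)%N = 0%N) //; lia.
have := dk j (Ordinal jl) (ltnSn _).
by have := IHn (Ordinal jl); rewrite /=; lia.
Qed.

(** A Kostka number is zero unless its shape dominates its content: the first u
   strips fit in the first u rows. *)
Lemma signed_matrices_dominance n kappa : decreasing kappa ->
  signed_matrices n kappa != 0 -> forall u, (u <= n)%N ->
  (\sum_(i < u) beta i + \sum_(j : 'I_l | (j < u)%N) staircase j <=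
   \sum_(j : 'I_l | (j < u)%N) kappa j)%N.
Proof.
elim: n kappa => [|n IHn] kappa dk nz u un.
  rewrite (_ : u = 0%N) ?big_ord0 ?big_pred0 //.
  by apply/eqP; rewrite -leqn0.
have [un'|] := leqP u n; last first.
  move=> nt; have {nt un} -> : u = n.+1 by apply/eqP; rewrite eqn_leq un nt.
  have := signed_matrices_weight nz; rewrite /weight.
  rewrite (bigID (fun j : 'I_l => j < n.+1)%N) /=.
  rewrite [X in _ = (_ + X)%N](bigID (fun j : 'I_l => j < n.+1)%N) /=.
  rewrite [X in (_ + X)%N = _](eq_bigr (fun j => staircase j)); first by lia.
  by move=> j; rewrite -leqNgt => /(signed_matrices_tail dk nz).
move: nz; rewrite signed_matrices_pieri // => nz.
have [mu /and3P[dmu wmu imu] mu0] : exists2 mu,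
    [&& dominated mu kappa, (weight mu + beta n == weight kappa)%N
      & interlaced mu kappa] & signed_matrices n mu != 0.
  apply/exists_inP; apply: contraNT nz => /exists_inPn h.
  by rewrite big1 // => mu /h; rewrite negbK => /eqP.
apply: leq_trans (IHn mu (interlaced_decreasing dk dmu imu) mu0 u un') _.
by apply: leq_sum => j _; apply: (forallP dmu).
Qed.

(** The first n rows of the partition underlying kappa. *)
Definition truncate kappa (n : nat) : Y :=
  [ffun j : 'I_l => if (j < n)%N then kappa j else inord (staircase j)].

Lemma truncateE kappa n j : decreasing kappa ->
  truncate kappa n j = (if (j < n)%N then kappa j : nat else staircase j) :> nat.
Proof.
move=> dk; rewrite ffunE; case: ifP => // _; rewrite inordK //.
by rewrite (leq_ltn_trans (decreasing_staircase dk j)).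
Qed.

(** When the content is the partition itself, dominance leaves one chain of
   interlaced exponents, which fills one row at a time. *)
Lemma signed_matrices_diag kappa n : decreasing kappa ->
  (forall j : 'I_l, (beta j + staircase j)%N = kappa j) -> (n <= l)%N ->
  signed_matrices n (truncate kappa n) = 1.
Proof.
move=> dk bk; have sk := decreasing_staircase dk.
have dt n' : decreasing (truncate kappa n').
  move=> i j ij; rewrite !truncateE //; have := dk i j ij; have := sk i.
  have : (staircase j < staircase i)%N by rewrite staircase_lt.
  by case: (ltnP j n'); case: (ltnP i n'); lia.
have up i n' : (truncate kappa n' i <= kappa i)%N.
  by rewrite truncateE //; case: ifP.
elim: n => [_|n IHn nl].
  rewrite signed_matrices0 //.
  by rewrite (_ : [forall j, _]) //; apply/forallP => j; rewrite truncateE.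
rewrite signed_matrices_pieri // (bigD1 (truncate kappa n)) /=; last first.
  apply/and3P; split.
  - apply/forallP => j; rewrite !truncateE //.
    by case: (ltnP j n) => [/ltnW|] //; case: (ltnP j n.+1) => //; lia.
  - rewrite /weight (bigD1 (Ordinal nl)) //= [X in _ == X](bigD1 (Ordinal nl)) //=.
    rewrite !truncateE // ltnn ltnSn -(bk (Ordinal nl)) addnAC.
    rewrite (addnC (staircase _)); apply/eqP; congr addn.
    apply: eq_bigr => j; rewrite -val_eqE /= => jn; rewrite !truncateE //.
    by rewrite ltnS [(j <= n)%N]leq_eqVlt (negPf jn).
  - apply/forallP => i; rewrite negb_exists; apply/forallP => j.
    apply/negP => /andP[/eqP ji]; apply/negP; rewrite -ltnNge.
    rewrite !truncateE // ji ltnS; have := dk i j; rewrite ji ltnSn => /(_ isT).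
    have : (staircase j < staircase i)%N by rewrite staircase_lt ji.
    by have := sk i; case: (ltnP i n); lia.
rewrite IHn ?(ltnW nl) // big1 ?addr0 // => mu /andP[/and3P[dmu wmu imu]].
apply: contraNeq => nz.
have tl := signed_matrices_tail (interlaced_decreasing (dt _) dmu imu) nz.
have le j : (mu j <= truncate kappa n j)%N.
  have := forallP dmu j; rewrite !truncateE //.
  case: (ltnP j n) => [jn|nj _]; first by rewrite ltnS (ltnW jn).
  by rewrite tl.
have ww : weight mu = weight (truncate kappa n).
  have := signed_matrices_weight nz.
  have : signed_matrices n (truncate kappa n) != 0 by rewrite IHn ?(ltnW nl).
  by move/signed_matrices_weight => -> ->.
have := leqif_sum (fun j (_ : true) => leqif_eq (le j)).
move=> /= [_]; rewrite -/(weight _) -/(weight _) ww eqxx => /esym /forallP h.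
by apply/eqP/ffunP => j; apply: val_inj; apply/eqP; apply: h.
Qed.

(** If beta is kappa minus a permuted staircase, dominance bounds the partial
   sums of s by those of the identity, which forces s to be the identity. *)
Lemma signed_matrices_dominant kappa s : decreasing kappa ->
  (forall j : 'I_l, (beta j + staircase (s j))%N = kappa j) ->
  signed_matrices l kappa = (s == 1%g).
Proof.
move=> dk bk; case: eqP => [s1|/eqP ns1].
  rewrite s1 in bk; rewrite -[LHS](_ : signed_matrices l (truncate kappa l) = _).
    rewrite signed_matrices_diag // => j; by rewrite -bk perm1.
  by congr signed_matrices; apply/ffunP => j; rewrite ffunE ltn_ord.
apply: contraNeq ns1 => nz; apply/eqP/permP => i; rewrite perm1.
case: i => n; have [m] := ubnP n; elim: m n => // m IHm n nm nl.
have sm j : (j < n)%N -> s j = j.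
  case: j => a al /= an; rewrite IHm ?(leq_trans an) //.
set i := Ordinal nl.
have := signed_matrices_dominance dk nz nl.
rewrite (big_ord_widen l) // [X in (_ <= X)%N](eq_bigr
  (fun j : 'I_l => beta j + staircase (s j))%N); last by move=> j _; rewrite bk.
rewrite big_split leq_add2l /=.
rewrite (bigD1 i) //= [X in (_ <= X)%N](bigD1 i) //=.
rewrite [X in (_ <= _ + X)%N](eq_bigr (fun j : 'I_l => staircase j)); last first.
  move=> j; rewrite ltnS -val_eqE /= andbC => jn.
  by rewrite sm // ltn_neqAle.
rewrite leq_add2r staircase_le leq_eqVlt => /orP[/eqP|/sm /perm_inj //].
exact: val_inj.
Qed.

End SignedMatrices.

(** * The irreducible character of a partition *)

Section SchurCharacter.
Variables (l k : nat) (la : 'I_l -> nat).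
Implicit Types (t u : 'S_l) (s : 'S_k).

(** The letter counts are la_j - j + t_j, the indices in the Jacobi-Trudi
   determinant; as nothing is subtracted, no word has a shape with a negative
   entry. *)
Definition has_shape (f : {ffun 'I_k -> 'I_l}) (t : 'S_l) : bool :=
  [forall j, (word_count f j + staircase (t j))%N == (la j + staircase j)%N].

(** The Jacobi-Trudi determinant of la with the complete symmetric functions
   replaced by the permutation characters on words with given letter counts: the
   character of the Specht module of la. *)
Definition schur_character (s : 'S_k) : int :=
  \sum_(t : 'S_l) (-1) ^+ t *
    #|[set f | has_shape f t & word_act f s == f]|%:Z.

Hypothesis la_sorted : forall i j : 'I_l, (i <= j)%N -> (la j <= la i)%N.
Hypothesis la_sum : (\sum_j la j)%N = k.

(* A bound for the entries of kappa and for letter counts. *)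
Let C := (k + l)%N.
Let kC : (k <= C)%N. Proof. exact: leq_addr. Qed.
Local Notation Y := {ffun 'I_l -> 'I_C.+1}.
Let kappa : Y := [ffun j => inord (la j + staircase j)].

Let kappaE j : kappa j = (la j + staircase j)%N :> nat.
Proof.
rewrite ffunE inordK // ltnS leq_add //; last exact: leq_subr.
by rewrite -la_sum (bigD1 j) //= leq_addr.
Qed.

Let kappa_decreasing : decreasing kappa.
Proof.
move=> i j ij; rewrite !kappaE -addnS leq_add ?la_sorted ?(ltnW ij) //.
by rewrite staircase_lt.
Qed.

Definition shape_words (t : 'S_l) := [set f | has_shape f t].

Let shape_words_acts t : [acts [set: 'S_k], on shape_words t | word_action k _].
Proof.
apply/subsetP => s _; rewrite !inE /=; apply/subsetP => f; rewrite !inE.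
by move=> /forallP h; apply/forallP => j; rewrite word_count_act.
Qed.

Let fixed_shape_words t s :
  #|('Fix_(shape_words t | word_action k _)[s])%g| =
  #|[set f | has_shape f t & word_act f s == f]|.
Proof. by apply: eq_card => f; rewrite !inE sub1set inE. Qed.

Let margins t u (m : {ffun 'I_l * 'I_l -> 'I_C.+1}) :=
  [forall i, (\sum_j (m (i, j) : nat) + staircase (t i))%N == kappa i] &&
  [forall j, (\sum_i (m (i, j) : nat) + staircase (u j))%N == kappa j].

(** A pair of words is a word in pairs of letters, whose letter counts form a
   matrix with the two given letter counts as margins. *)
Let pair_words t u s :
  (#|[set f | has_shape f t & word_act f s == f]| *
   #|[set f | has_shape f u & word_act f s == f]|)%N =
  #|[set f : {ffun 'I_k -> 'I_l * 'I_l} |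
      margins t u (bounded_count C f) & word_act f s == f]|.
Proof.
rewrite -cardsX.
pose F (f : {ffun 'I_k -> 'I_l * 'I_l}) :
    {ffun 'I_k -> 'I_l} * {ffun 'I_k -> 'I_l} :=
  ([ffun p => (f p).1], [ffun p => (f p).2]).
have Fi : injective F.
  move=> f g [/ffunP e1 /ffunP e2]; apply/ffunP => p.
  by have := e1 p; have := e2 p; rewrite !ffunE; case: (f p) (g p) => ? ? [? ?] /= -> ->.
have count1 f i : word_count (F f).1 i = (\sum_j word_count f (i, j))%N.
  rewrite /word_count -sum1_card (partition_big (fun p => (f p).2) predT) //=.
  apply: eq_bigr => j _; rewrite sum1dep_card; apply: eq_card => p.
  by rewrite !inE ffunE; case: (f p) => a b /=; rewrite xpair_eqE.
have count2 f j : word_count (F f).2 j = (\sum_i word_count f (i, j))%N.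
  rewrite /word_count -sum1_card (partition_big (fun p => (f p).1) predT) //=.
  apply: eq_bigr => i _; rewrite sum1dep_card; apply: eq_card => p.
  by rewrite !inE ffunE; case: (f p) => a b /=; rewrite xpair_eqE andbC.
have Fact f : ((word_act (F f).1 s == (F f).1) && (word_act (F f).2 s == (F f).2))
            = (word_act f s == f).
  rewrite -(inj_eq Fi) [RHS]xpair_eqE.
  by congr (_ && _); congr (_ == _); apply/ffunP => p; rewrite !ffunE.
have mE f : margins t u (bounded_count C f) =
    has_shape (F f).1 t && has_shape (F f).2 u.
  rewrite /margins /has_shape; congr (_ && _); apply: eq_forallb => i.
    by rewrite count1 kappaE; under eq_bigr do rewrite bounded_countE //.
  by rewrite count2 kappaE; under eq_bigr do rewrite bounded_countE //.
rewrite -[RHS](card_imset _ Fi); apply: eq_card => -[f1 f2]; rewrite !inE /=.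
apply/idP/imsetP => [/andP[/andP[h1 w1] /andP[h2 w2]]|[f]].
  have eF : (f1, f2) = F [ffun p => (f1 p, f2 p)].
    by congr pair; apply/ffunP => p; rewrite !ffunE.
  by exists [ffun p => (f1 p, f2 p)] => //; rewrite inE mE -Fact -eF /= h1 h2 w1.
by rewrite inE mE -Fact => /andP[/andP[h1 h2] /andP[w1 w2]] [-> ->];
  do 2! [apply/andP; split].
Qed.

Local Notation G := [set: 'S_k]%G.

Let pi_ex t : exists chi : 'CF(G), (chi \is a character) &&
  [forall s, chi s == #|[set f | has_shape f t & word_act f s == f]|%:R].
Proof.
have [chi chic chiE] := permutation_character (shape_words_acts t).
exists chi; rewrite chic; apply/forallP => s.
by rewrite chiE ?inE // fixed_shape_words.
Qed.

Let pi t := xchoose (pi_ex t).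

Let pi_char t : pi t \is a character.
Proof. by have /andP[] := xchooseP (pi_ex t). Qed.

Let piE t s : pi t s = #|[set f | has_shape f t & word_act f s == f]|%:R.
Proof. by have /andP[_ /forallP/(_ s)/eqP] := xchooseP (pi_ex t). Qed.

Let Phi := \sum_(t : 'S_l) (-1) ^+ t *: pi t.

Let PhiE s : Phi s = (schur_character s)%:~R.
Proof.
rewrite /Phi sum_cfunE rmorph_sum /=; apply: eq_bigr => t _.
by rewrite cfunE piE rmorphM /= rmorph_sign.
Qed.

Let kfact_neq0 : k`!%:R != 0 :> algC.
Proof. by rewrite pnatr_eq0 -lt0n fact_gt0. Qed.

Let cardG : #|G| = k`!.
Proof. by rewrite cardsT card_Sn. Qed.

Let cfdot_pi t u :
  '[pi t, pi u] = #|[set m | margins t u m & (\sum_x m x)%N == k]|%:R.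
Proof.
rewrite cfdotE cardG; apply: (canLR (mulKf kfact_neq0)); rewrite -natrM mulnC.
rewrite -(burnside_words kC) natr_sum; apply: eq_big => [s|s _]; first by rewrite inE.
by rewrite !piE conjC_nat -natrM pair_words.
Qed.

(** Row sums beta make the total equal to k. *)
Let margins_matrices t u (beta : nat -> nat) :
    (forall j : 'I_l, (beta j + staircase (t j))%N = kappa j) ->
  #|[set m | margins t u m & (\sum_x m x)%N == k]| =
  #|[set m | @matrix_ok l C beta l m u kappa]|.
Proof.
move=> hb.
pose F (m : {ffun 'I_l * 'I_l -> 'I_C.+1}) : {ffun 'I_l -> Y} :=
  [ffun i => [ffun j => m (i, j)]].
have Fi : injective F.
  move=> m m' /ffunP e; apply/ffunP => -[i j].
  by have /ffunP/(_ j) := e i; rewrite !ffunE.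
rewrite -[LHS](card_imset _ Fi); apply: eq_card => m; rewrite [RHS]inE.
apply/imsetP/andP => [[m' + ->]|[/forallP rm /forallP cm]].
  rewrite inE => /andP[/andP[/forallP rm /forallP cm] _]; split.
    apply/forallP => i; rewrite -(eqn_add2r (staircase (t i))) hb -(eqP (rm i)).
    by rewrite /weight; under eq_bigr do rewrite !ffunE.
  apply/forallP => j; rewrite -(eqP (cm j)).
  by under eq_bigr do rewrite !ffunE.
exists [ffun x => m x.1 x.2]; last first.
  by apply/ffunP => i; apply/ffunP => j; rewrite !ffunE.
have rsum i : (\sum_j m i j)%N = beta i := eqP (rm i).
rewrite inE -andbA; apply/and3P; split.
- apply/forallP => i; rewrite -hb eqn_add2r -rsum; apply/eqP.
  by apply: eq_bigr => j _; rewrite ffunE.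
- apply/forallP => j; rewrite -(eqP (cm j)) eqn_add2r; apply/eqP.
  by apply: eq_bigr => i _; rewrite ffunE.
rewrite (eq_bigr (fun x => m x.1 x.2 : nat)); last by move=> x _; rewrite ffunE.
rewrite -(pair_bigA _ (fun i j => m i j : nat)) /= -la_sum.
rewrite -(eqn_add2r (\sum_(j < l) staircase j)%N) -[X in _ == X]big_split.
rewrite [X in (_ + X)%N == _](reindex_inj (@perm_inj _ t)) -big_split.
by apply/eqP/eq_bigr => i _ /=; rewrite -kappaE -hb -rsum.
Qed.

(** By Burnside's lemma these inner products are signed counts of matrices. *)
Let cfdot_pi_Phi t : '[pi t, Phi] = (t == 1%g)%:R.
Proof.
have -> : '[pi t, Phi] =
    (\sum_(u : 'S_l) (-1) ^+ u * #|[set m | margins t u m & (\sum_x m x)%N == k]|%:Z)%:~R.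
  rewrite /Phi cfdot_sumr rmorph_sum; apply: eq_bigr => u _.
  by rewrite cfdotZr cfdot_pi rmorphM /= !rmorph_sign.
have [/forallP tk|/forallPn[j nj]] :=
    boolP [forall j, (staircase (t j) <= kappa j)%N].
  pose beta n := oapp (fun j => kappa j - staircase (t j))%N 0%N (insub n).
  have hb (j : 'I_l) : (beta j + staircase (t j))%N = kappa j.
    by rewrite /beta valK /= subnK.
  rewrite [RHS]pmulrn -(signed_matrices_dominant kappa_decreasing hb).
  congr _%:~R; apply: eq_bigr => u _.
  by rewrite (margins_matrices u hb).
rewrite big1 => [|u _].
  case: eqP nj => // ->; rewrite perm1 kappaE; lia.
rewrite eq_card0 ?mulr0 // => m; rewrite !inE.
apply/negP => /andP[/andP[/forallP/(_ j)/eqP h _] _].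
by case/negP: nj; rewrite -h leq_addl.
Qed.

(** A virtual character of norm 1 is irreducible up to sign, and its inner product
   with the character pi 1 is not negative. *)
Let Phi_irr : exists i, Phi = 'chi_i.
Proof.
have PhiZ : Phi \in ('Z[irr G])%g.
  by apply: rpred_sum => t _; rewrite rpredZsign char_vchar.
have [|b [i Phii]] := vchar_norm1P PhiZ.
  rewrite {1}/Phi cfdot_suml (bigD1 1%g) //= cfdotZl cfdot_pi_Phi eqxx mulr1.
  rewrite odd_perm1 big1 ?addr0 // => t nt.
  by rewrite cfdotZl cfdot_pi_Phi (negPf nt) mulr0.
case: b Phii => [/esym|]; last by rewrite expr0 scale1r => ->; exists i.
rewrite expr1 scaleN1r => eP; have := cfdot_pi_Phi 1%g.
have /natr_ge0 := Cnat_cfdot_char (pi_char 1%g) (irr_char i).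
rewrite -eP eqxx cfdotNr => h0 h1.
by have := @ltr01 algC; rewrite -[X in _ < X]h1 oppr_gt0 le_gtF.
Qed.

(** A permutation and its inverse fix the same words. *)
Lemma schur_character_inv s : schur_character s^-1 = schur_character s.
Proof.
apply: eq_bigr => t _; congr (_ * _%:Z); apply: eq_card => f; rewrite !inE.
congr andb; apply/eqP/eqP => e; rewrite -{1}e.
  by rewrite -[word_act _ _]/(word_action k _ _ _) (actKV (word_action k _)).
exact: (actK (word_action k _)).
Qed.

Lemma schur_character1_gt0 : 0 < schur_character 1.
Proof.
by have [i Phii] := Phi_irr; rewrite -(ltr0z algC) -PhiE Phii irr1_gt0.
Qed.

(** The generalized orthogonality relation for an irreducible character. *)
Lemma schur_character_convolution s :
  schur_character 1 * \sum_(x : 'S_k) schur_character (x * s) * schur_character x =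
  k`!%:Z * schur_character s.
Proof.
have [i Phii] := Phi_irr.
have := generalized_orthogonality_relation s i i.
rewrite eqxx mul1r -!Phii cardG => e.
apply: (@intr_inj algC); rewrite !rmorphM /= -!PhiE.
have P1 : Phi 1%g != 0 by rewrite Phii irr1_neq0.
have -> : (\sum_(x : 'S_k) schur_character (x * s) * schur_character x)%:~R =
    \sum_(x in G) Phi (x * s)%g * Phi x^-1%g.
  rewrite rmorph_sum; apply: eq_big => [x|x _]; first by rewrite inE.
  by rewrite -(schur_character_inv x) rmorphM /= -!PhiE.
rewrite (canRL (mulKf (invr_neq0 kfact_neq0)) e) invrK mulrCA; congr (_ * _).
by rewrite mulrC divfK.
Qed.

End SchurCharacter.

(** * Principal minors *)

Section ExtendPerm.
Variables (T' T : finType) (g : T' -> T).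
Hypothesis gI : injective g.
Implicit Types (s t : {perm T'}).

Definition extend_fun s (x : T) : T :=
  oapp (fun y => g (s y)) x [pick y | g y == x].

Lemma extend_fun_in s y : extend_fun s (g y) = g (s y).
Proof.
rewrite /extend_fun; case: pickP => [z /eqP/gI -> //|/(_ y)].
by rewrite eqxx.
Qed.

Lemma extend_fun_out s x : x \notin codom g -> extend_fun s x = x.
Proof.
move=> nx; rewrite /extend_fun; case: pickP => // z /eqP e.
by case/negP: nx; rewrite -e codom_f.
Qed.

Lemma extend_fun_inj s : injective (extend_fun s).
Proof.
apply: (can_inj (g := extend_fun s^-1)) => x.
have [/codomP[y ->]|nx] := boolP (x \in codom g).
  by rewrite !extend_fun_in permK.
by rewrite !extend_fun_out.
Qed.

Definition extend_perm s : {perm T} := perm (@extend_fun_inj s).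

Lemma extend_perm_in s y : extend_perm s (g y) = g (s y).
Proof. by rewrite permE extend_fun_in. Qed.

Lemma extend_perm_out s x : x \notin codom g -> extend_perm s x = x.
Proof. by rewrite permE; apply: extend_fun_out. Qed.

Lemma extend_permM : {morph extend_perm : s t / (s * t)%g}.
Proof.
move=> s t; apply/permP => x; rewrite permM.
have [/codomP[y ->]|nx] := boolP (x \in codom g).
  by rewrite !extend_perm_in permM.
by rewrite !extend_perm_out.
Qed.

Lemma extend_perm1 : extend_perm 1 = 1%g.
Proof. by apply: (mulgI (extend_perm 1)); rewrite -extend_permM !mulg1. Qed.

Lemma extend_perm_inj : injective extend_perm.
Proof.
move=> s t e; apply/permP => y; apply: gI.
by rewrite -!extend_perm_in e.
Qed.

(** Both sides are multiplicative, and transpositions extend to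
   transpositions. *)
Lemma odd_extend_perm s : odd_perm (extend_perm s) = odd_perm s.
Proof.
have [ts -> _] := prod_tpermP s.
elim: ts => [|[a b] ts IHts]; rewrite ?big_nil ?big_cons ?extend_perm1 ?odd_perm1 //.
rewrite extend_permM !odd_permM IHts; congr addb.
rewrite (_ : extend_perm _ = tperm (g a) (g b)) ?odd_tperm ?(inj_eq gI) //.
apply/permP => x; have [/codomP[y ->]|nx] := boolP (x \in codom g).
  rewrite extend_perm_in; case: tpermP => [->|->|/eqP ya /eqP yb] /=.
  - by rewrite tpermL.
  - by rewrite tpermR.
  - by rewrite tpermD // (inj_eq gI) eq_sym.
by rewrite extend_perm_out // tpermD //; apply: contraNneq nx => <-; apply: codom_f.
Qed.

Lemma perm_on_extend (S : {set T'}) s :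
  perm_on (g @: S) (extend_perm s) = perm_on S s.
Proof.
apply/subsetP/subsetP => h x; rewrite inE => sx.
  have := h (g x); rewrite inE extend_perm_in (inj_eq gI) (mem_imset _ _ gI).
  by apply.
have [/codomP[y ey]|nx] := boolP (x \in codom g); last first.
  by rewrite extend_perm_out ?eqxx in sx.
rewrite ey extend_perm_in (inj_eq gI) in sx.
by rewrite ey (mem_imset _ _ gI); apply: h; rewrite inE.
Qed.

(** Both sets have #|S|! elements. *)
Lemma perm_on_imset (S : {set T'}) :
  [set s | perm_on (g @: S) s] = extend_perm @: [set s | perm_on S s].
Proof.
apply/esym/eqP; rewrite eqEcard; apply/andP; split.
  apply/subsetP => _ /imsetP[s sS ->]; rewrite inE in sS.
  by rewrite inE perm_on_extend.
rewrite (card_imset _ extend_perm_inj) !cardsE.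
by rewrite !card_perm (card_imset _ gI).
Qed.

End ExtendPerm.

Section Minors.
Variables (K : comNzRingType).

(** The Leibniz formula runs over the permutations supported in J, so no ordering
   of the finite type T is needed. *)
Definition minor (T : finType) (B : T -> T -> K) (J : {set T}) : K :=
  \sum_(s : {perm T} | perm_on J s) (-1) ^+ s * \prod_(p in J) B p (s p).

Lemma minor_imset (T' T : finType) (g : T' -> T) B (J : {set T'}) :
  injective g ->
  minor B (g @: J) = minor (fun x y => B (g x) (g y)) J.
Proof.
move=> gI; rewrite /minor.
transitivity (\sum_(s in extend_perm gI @: [set s | perm_on J s])
   (-1) ^+ odd_perm s * \prod_(p in g @: J) B p (s p)).
  by rewrite -perm_on_imset; apply: eq_bigl => s; rewrite inE.
rewrite big_imset /=; last by move=> s t _ _; apply: extend_perm_inj.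
apply: eq_big => [s|s _]; first by rewrite inE.
rewrite odd_extend_perm; congr (_ * _).
rewrite big_imset /=; last by move=> x y _ _; apply: gI.
by apply: eq_bigr => x _; rewrite extend_perm_in.
Qed.

Lemma eq_minor (T : finType) (B B' : T -> T -> K) J :
  (forall x y, B x y = B' x y) -> minor B J = minor B' J.
Proof.
move=> e; apply: eq_bigr => s _; congr (_ * _).
by apply: eq_bigr.
Qed.

Lemma minor0 (T : finType) (B : T -> T -> K) : minor B finset.set0 = 1.
Proof.
rewrite /minor (big_pred1 1%g) => [|s].
  by rewrite odd_perm1 mul1r big1 // => i; rewrite inE.
apply/idP/eqP => [|->]; last exact: perm_on1.
by move/perm_on_id; apply; rewrite cards0.
Qed.

Lemma minor_setT n (A : 'M[K]_n) : minor (fun i j => A i j) setT = \det A.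
Proof.
apply: eq_big => [s|s _]; first by apply/subsetP => x; rewrite inE.
by congr (_ * _); apply: eq_bigl => i; rewrite inE.
Qed.

(** Block triangularity: the Leibniz term of a permutation that does not preserve
   J contains a factor B p q with p in J and q in J'; the others factor. *)
Lemma minor_setU (T : finType) (B : T -> T -> K) (J J' : {set T}) :
    [disjoint J & J'] -> (forall p q, p \in J -> q \in J' -> B p q = 0) ->
  minor B (J :|: J') = minor B J * minor B J'.
Proof.
move=> dJ B0.
have J'x x : x \in J -> x \in J' = false by move=> xJ; rewrite (disjointFr dJ xJ).
have offJ x (u : {perm T}) : perm_on J u -> x \in J' -> u x = x.
  by move=> Ju xJ'; rewrite (out_perm Ju) // (disjointFl dJ xJ').
rewrite /minor mulr_suml (bigID (fun s : {perm T} => s \in 'N(J | 'P))%g) /=.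
rewrite [X in _ + X]big1 ?addr0; last first.
  move=> s /andP[Js ns]; rewrite (_ : \prod_(_ in _) _ = 0) ?mulr0 //.
  have /subsetPn[x xJ sx] : ~~ (J \subset s @^-1: J).
    by apply: contra ns => h; rewrite !inE.
  rewrite (bigD1 x) ?inE ?xJ //= B0 ?mul0r //.
  have := perm_closed x Js; rewrite !inE xJ /=.
  by rewrite inE in sx; rewrite (negPf sx).
under [RHS]eq_bigr do rewrite mulr_sumr.
rewrite [RHS]pair_big_dep /=.
rewrite (reindex_onto (fun p : {perm T} * {perm T} => (p.1 * p.2)%g)
  (fun s => (restr_perm J s, (restr_perm J s)^-1 * s))%g) /=; last first.
  by move=> s _; rewrite mulKVg.
have stab (u v : {perm T}) : perm_on J u -> perm_on J' v -> (u * v)%g \in ('N(J | 'P))%g.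
  move=> Ju J'v; rewrite !inE; apply/subsetP => x xJ; rewrite !inE /= /aperm permM.
  by rewrite (out_perm J'v) ?(perm_closed _ Ju) // J'x // (perm_closed _ Ju).
have restr (u v : {perm T}) : perm_on J u -> perm_on J' v -> restr_perm J (u * v) = u.
  move=> Ju J'v; apply/permP => x; have [xJ|nx] := boolP (x \in J).
    by rewrite restr_permE ?stab // permM (out_perm J'v) // J'x // (perm_closed _ Ju).
  by rewrite (out_perm (restr_perm_on _ _)) // (out_perm Ju).
apply: eq_big => [[u v] /=|[u v] /=].
  apply/idP/idP => [/andP[/andP[Juv nuv] /eqP[eu _]]|/andP[Ju J'v]]; last first.
    rewrite stab // restr // mulKg eqxx !andbT perm_onM //.
      exact: subset_trans Ju (subsetUl _ _).
    exact: subset_trans J'v (subsetUr _ _).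
  have Ju : perm_on J u by rewrite -eu restr_perm_on.
  rewrite Ju /=; apply/subsetP => x; rewrite inE.
  have -> : v = (u^-1 * (u * v))%g by rewrite mulKg.
  rewrite permM => nx; have [xJ|nJ] := boolP (x \in J).
    case/negP: nx; rewrite -(restr_permE nuv) ?eu ?permKV //.
    by rewrite (perm_closed _ (perm_onV Ju)).
  move: nx; rewrite (out_perm (perm_onV Ju)) // => nx.
  have /subsetP/(_ x) := Juv; rewrite inE nx => /(_ isT).
  by rewrite inE (negPf nJ).
case/andP=> /andP[Juv nuv] /eqP[eu _].
have Ju : perm_on J u by rewrite -eu restr_perm_on.
rewrite (eq_bigl [predU J & J']); last by move=> x; rewrite !inE.
rewrite bigU //= odd_permM signr_addb mulrACA; congr ((_ * _) * (_ * _)).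
  apply: eq_bigr => p pJ; rewrite -{2}eu restr_permE //.
by apply: eq_bigr => p pJ'; rewrite permM (offJ p).
Qed.


(** The matrix is block diagonal with l blocks W, one for each first index. *)
Lemma minor_blocks (l r : nat) (W : 'M[K]_r) (J : {set 'I_l * 'I_r}) :
  minor (fun x y => W x.2 y.2 *+ (x.1 == y.1)) J =
  \prod_(j < l) minor (fun p q => W p q) [set i | (j, i) \in J].
Proof.
set B := (fun x y => _); pose below n := [set x in J | (x.1 < n)%N].
suff H n (nl : (n <= l)%N) : minor B (below n) =
    \prod_(j : 'I_l | (j < n)%N) minor (fun p q => W p q) [set i | (j, i) \in J].
  have bl : J = below l by apply/setP => x; rewrite inE ltn_ord andbT.
  by rewrite [X in minor _ X]bl H //; apply: eq_bigl => j; rewrite ltn_ord.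
elim: n nl => [_|n IHn nl].
  rewrite big_pred0 // (_ : below 0%N = finset.set0) ?minor0 //.
  by apply/setP => x; rewrite !inE andbF.
have gI : injective (fun i : 'I_r => (Ordinal nl, i)) by move=> i i' [].
have -> : below n.+1 = below n :|:
    (fun i => (Ordinal nl, i)) @: [set i | (Ordinal nl, i) \in J].
  apply/setP => -[j i]; rewrite !inE /= ltnS leq_eqVlt andb_orr orbC.
  congr orb; apply/andP/imsetP => [[jiJ /eqP jn]|[i']].
    have ej : j = Ordinal nl by apply: val_inj.
    by exists i; rewrite ?inE -ej.
  by rewrite inE => iJ [-> ->].
rewrite minor_setU; first last.
- move=> [j i] [j' i']; rewrite inE /= => /andP[_ jn] /imsetP[i'' _ [-> _]].
  by rewrite /B /= -val_eqE /= ltn_eqF.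
- rewrite -setI_eq0; apply/eqP/setP => -[j i]; rewrite !inE /=.
  by apply/negP => /andP[/andP[_ jn] /imsetP[i' _ [ej _]]]; rewrite ej ltnn in jn.
rewrite IHn ?(ltnW nl) // [RHS](bigD1 (Ordinal nl)) //= mulrC; congr (_ * _).
  by rewrite minor_imset //; apply: eq_minor => x y; rewrite /B /= eqxx.
apply: eq_bigl => j; rewrite ltnS -val_eqE /= [(j <= n)%N]leq_eqVlt.
by case: ltngtP.
Qed.

(** A Leibniz term of a permutation s is multiplied out by choosing the set J of
   the rows where the entry of W is taken; elsewhere s has to fix the index. *)
Lemma det_expansion r (W : 'M[K]_r) k : (k <= r)%N ->
  (\det ('X%:M + map_mx polyC W))`_(r - k) =
  \sum_(J : {set 'I_r} | #|J| == k) minor (fun i j => W i j) J.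
Proof.
move=> kr; rewrite /minor; under [RHS]eq_bigr do rewrite big_mkcond.
rewrite exchange_big coef_sum; apply: eq_bigr => s _ /=.
have -> : \prod_i ('X%:M + map_mx polyC W) i (s i) =
    \sum_(J : {set 'I_r} | perm_on J s)
      (\prod_(i in J) W i (s i))%:P * 'X^(r - #|J|).
  under eq_bigr do rewrite !mxE addrC.
  rewrite bigA_distr [RHS]big_mkcond; apply: eq_bigr => J _.
  rewrite (bigID (mem J)) /= (eq_bigr (fun i => (W i (s i))%:P)); last first.
    by move=> i ->.
  rewrite -rmorph_prod /=.
  have [/subsetP Js|/subsetPn[i si iJ]] := boolP (perm_on J s); last first.
    rewrite [X in _ * X](bigD1 i) //= (negPf iJ).
    by rewrite inE eq_sym in si; rewrite (negPf si) mulr0n mul0r mulr0.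
  congr (_ * _); rewrite (eq_bigr (fun=> 'X)); last first.
    move=> i niJ; rewrite (negPf niJ) (_ : s i = i) ?eqxx //.
    by apply/eqP/negPn; apply: contra niJ => si; apply: Js; rewrite inE.
  rewrite prodr_const; congr ('X^_); rewrite -[X in (X - _)%N]card_ord.
  by rewrite -(cardC (mem J)) addKn; apply: eq_card.
rewrite -signr_odd -polyC1 -polyCN -polyC_exp coefCM coef_sum signr_odd.
rewrite big_mkcond [RHS]big_mkcond mulr_sumr; apply: eq_bigr => J _.
case: (perm_on J s); last by rewrite mulr0 if_same.
rewrite coefCM coefXn eq_sym.
have JR : (#|J| <= r)%N by rewrite -[X in (_ <= X)%N]card_ord max_card.
have -> : (r - #|J| == r - k)%N = (#|J| == k) by lia.
by case: eqP => _; rewrite ?mulr1 // !mulr0.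
Qed.

(** A word with a repeated letter gives a determinant with equal rows, and every
   set of k letters is the image of k! words without repetition. *)
Lemma sum_minor_words (T : finType) (B : T -> T -> K) k
    (Q : pred {ffun 'I_k -> T}) (P : pred {set T}) :
    (forall g : {ffun 'I_k -> T}, injective g -> Q g = P [set g p | p : 'I_k]) ->
  \sum_(g | Q g) \det (\matrix_(p, q) B (g p) (g q)) =
  k`!%:R * \sum_(J : {set T} | (#|J| == k) && P J) minor B J.
Proof.
move=> QP; pose im (g : {ffun 'I_k -> T}) := [set g p | p : 'I_k].
rewrite (bigID (fun g : {ffun 'I_k -> T} => injectiveb g)) /=.
rewrite [X in _ + X]big1 ?addr0; last first.
  move=> g /andP[_ /injectivePn[p [q pq e]]].
  by apply: (determinant_alternate pq) => a; rewrite !mxE e.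
rewrite (partition_big im (fun J => (#|J| == k) && P J)) /=; last first.
  move=> g /andP[Qg /injectiveP gI].
  by rewrite -QP // Qg card_imset // card_ord eqxx.
rewrite mulr_sumr; apply: eq_bigr => J /andP[/eqP Jk PJ].
rewrite (eq_bigr (fun=> minor B J)); last first.
  move=> g /andP[/andP[_ /injectiveP gI] /eqP <-].
  rewrite /im (_ : [set g p | p : 'I_k] = g @: setT); last first.
    by apply/setP => x; apply/imsetP/imsetP => -[p _ ->]; exists p; rewrite ?inE.
  rewrite minor_imset // -minor_setT; apply: eq_minor => p q; by rewrite mxE.
rewrite sumr_const -[LHS]mulr_natl; congr (_%:R * _).
have := @card_inj_ffuns_on 'I_k T (mem J).
rewrite [#|mem J|]Jk card_ord ffactnn => <-.
apply: eq_card => g; rewrite !inE unfold_in.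
apply/andP/andP => [[/andP[Qg gI] /eqP eJ]|[/ffun_onP gJ gI]].
  by split=> //; apply/ffun_onP => p; rewrite -eJ imset_f.
have eJ : im g = J.
  apply/eqP; rewrite eqEcard card_imset ?card_ord ?Jk ?leqnn ?andbT //.
    by apply/subsetP => _ /imsetP[p _ ->].
  exact/injectiveP.
by rewrite gI QP -?/(im g) ?eJ ?PJ ?eqxx //; apply: (elimT (injectiveP _)).
Qed.

End Minors.

(** * The Frobenius formula for Jacobi-Trudi determinants *)

Section SchurDeterminant.
Variables (K : comNzRingType) (r : nat) (W : 'M[K]_r).

(** The elementary symmetric functions of the eigenvalues of W, extended by 0 to
   all integer indices. *)
Definition elementary (z : int) : K :=
  match z with
  | Posz m => if (m <= r)%N then (\det ('X%:M + map_mx polyC W))`_(r - m) else 0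
  | Negz _ => 0
  end.

Lemma elementaryE (m : nat) :
  elementary m = \sum_(J : {set 'I_r} | #|J| == m) minor (fun i j => W i j) J.
Proof.
rewrite /elementary; case: leqP => [/det_expansion -> //|rm].
rewrite big_pred0 // => J; apply/eqP => e; move: rm; rewrite -e ltnNge.
by rewrite -[X in (_ <= X)%N]card_ord max_card.
Qed.

(** A product of l minors of W is a minor of the block-diagonal matrix with l
   blocks W.  The words indexing the latter are pairs of a word f in the numbers
   of the blocks and a word i in the indices of W; the Leibniz term of s survives
   in it when s fixes f. *)
Lemma prod_elementary l k (al : 'I_l -> nat) : (\sum_j al j)%N = k ->
  k`!%:R * \prod_j elementary (al j) =
  \sum_(s : 'S_k) (-1) ^+ s *
    #|[set f : {ffun 'I_k -> 'I_l} |
        [forall j, word_count f j == al j] & word_act f s == f]|%:R *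
    \sum_(i : {ffun 'I_k -> 'I_r}) \prod_p W (i p) (i (s p)).
Proof.
move=> alk.
pose slice (J : {set 'I_l * 'I_r}) j := [set i | (j, i) \in J].
pose P (J : {set 'I_l * 'I_r}) := [forall j, #|slice J j| == al j].
have PJ J : P J -> #|J| == k.
  move=> /forallP h; rewrite -alk -sum1_card; apply/eqP.
  rewrite (eq_bigl (fun x => x.2 \in slice J x.1)); last first.
    by case=> j i; rewrite inE.
  rewrite -(pair_big_dep predT (fun j i => i \in slice J j) (fun _ _ => 1%N)) /=.
  by apply: eq_bigr => j _; rewrite sum1_card; apply/eqP/h.
have -> : \prod_j elementary (al j) =
    \sum_(J : {set 'I_l * 'I_r} | (#|J| == k) && P J)
    minor (fun x y => W x.2 y.2 *+ (x.1 == y.1)) J.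
  under [RHS]eq_bigr => J _ do rewrite minor_blocks.
  rewrite [RHS](eq_bigl P); last first.
    by move=> J; apply/andP/idP => [[]//|pJ]; rewrite PJ.
  under eq_bigr do rewrite elementaryE.
  rewrite bigA_distr_big_dep /=.
  pose glue (F : {ffun 'I_l -> {set 'I_r}}) := [set x : 'I_l * 'I_r | x.2 \in F x.1].
  rewrite [RHS](reindex glue) /=; last first.
    exists (fun J : {set 'I_l * 'I_r} => [ffun j => slice J j]) => [F _|J _].
      by apply/ffunP => j; apply/setP => i; rewrite ffunE !inE.
    by apply/setP => -[j i]; rewrite inE ffunE inE.
  have sg F j : slice (glue F) j = F j by apply/setP => i; rewrite !inE.
  apply: eq_big => [F|F _]; last first.
    by apply: eq_bigr => j _; rewrite -[X in minor _ X]sg.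
  apply/familyP/forallP => h j; first by rewrite sg; apply: h.
  by have := h j; rewrite sg.
have <- := @sum_minor_words K ('I_l * 'I_r)%type _ k
   (fun g => [forall j, word_count [ffun p => (g p).1] j == al j]) P; last first.
  move=> g gI; apply: eq_forallb => j; congr (_ == _).
  rewrite /word_count -(card_imset _ gI).
  rewrite -[RHS](card_imset (f := fun i => (j, i))); last by move=> i i' [].
  apply: eq_card => -[j' i']; apply/imsetP/imsetP => [[p]|[i]].
    rewrite inE ffunE => /eqP pj e; exists (g p).2; last by rewrite e -pj; case: (g p).
    by rewrite inE -pj; apply/imsetP; exists p => //; case: (g p).
  rewrite inE => /imsetP[p _ e] ->; exists p => //.
  by rewrite inE ffunE -e.
pose pr (g : {ffun 'I_k -> 'I_l * 'I_r}) : {ffun 'I_k -> 'I_l} * {ffun 'I_k -> 'I_r}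
  := ([ffun p => (g p).1], [ffun p => (g p).2]).
rewrite (reindex (fun fi : {ffun 'I_k -> 'I_l} * {ffun 'I_k -> 'I_r} =>
   [ffun p => (fi.1 p, fi.2 p)])) /=; last first.
  exists pr => [[f i] _|g _]; rewrite /pr /=.
    by congr pair; apply/ffunP => p; rewrite !ffunE.
  by apply/ffunP => p; rewrite !ffunE; case: (g p).
rewrite /determinant exchange_big; apply: eq_bigr => s _ /=.
rewrite -mulr_sumr -mulrA; congr (_ * _).
rewrite (eq_bigl (fun fi => [forall j, word_count fi.1 j == al j] && true)); last first.
  move=> [f i] /=; rewrite andbT; apply: eq_forallb => j; congr (_ == _).
  by apply: eq_card => p; rewrite !inE !ffunE.
under eq_bigr do under eq_bigr do rewrite mxE !ffunE /=.
rewrite -(pair_big_dep (fun f => [forall j, word_count f j == al j])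
  (fun _ _ => true) (fun (f : {ffun 'I_k -> 'I_l}) (i : {ffun 'I_k -> 'I_r}) =>
  \prod_p (W (i p) (i (s p)) *+ (f p == f (s p))))) /=.
rewrite mulr_natl -sumr_const [RHS]big_mkcond [LHS]big_mkcond /=.
apply: eq_bigr => f _; rewrite inE; case: ifP => //= _.
have fixE : (word_act f s == f) = [forall p, f p == f (s p)].
  apply/eqP/forallP => [e p|h].
    by have /ffunP/(_ (s p)) := e; rewrite ffunE permK => ->.
  by apply/ffunP => p; rewrite ffunE (eqP (h _)) permKV.
rewrite fixE; case: forallP => [h|/forallP/forallPn[p np]].
  by apply: eq_bigr => i _; apply: eq_bigr => p _; rewrite h.
by apply: big1 => i _; rewrite (bigD1 p) //= (negPf np) mul0r.
Qed.

(** Frobenius' formula: the permutation characters of the l-fold products add up,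
   with the signs of the determinant, to the character of la. *)
Lemma schur_determinant l k (la : 'I_l -> nat) : (\sum_j la j)%N = k ->
  k`!%:R * \det (\matrix_(j < l, j' < l) elementary ((la j)%:Z - j%:Z + j'%:Z)) =
  \sum_(s : 'S_k) (-1) ^+ s * (schur_character la s)%:~R *
    \sum_(i : {ffun 'I_k -> 'I_r}) \prod_p W (i p) (i (s p)).
Proof.
move=> lak; rewrite /determinant mulr_sumr.
pose N t s := #|[set f : {ffun 'I_k -> 'I_l} | has_shape la f t & word_act f s == f]|.
rewrite (eq_bigr (fun t : 'S_l => \sum_(s : 'S_k) (-1) ^+ t * ((-1) ^+ s *
    (N t s)%:R * \sum_(i : {ffun 'I_k -> 'I_r}) \prod_p W (i p) (i (s p))))); last first.
  move=> t _; rewrite mulrCA -mulr_sumr; congr (_ * _).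
  under eq_bigr do rewrite mxE.
  have [/forallP h|/forallPn[j nj]] :=
      boolP [forall j, (staircase (t j) <= la j + staircase j)%N].
    pose al j := (la j + staircase j - staircase (t j))%N.
    have alE j : (la j)%:Z - j%:Z + (t j)%:Z = al j.
      have := h j; rewrite /al /staircase.
      by have := ltn_ord j; have := ltn_ord (t j); lia.
    under eq_bigr do rewrite alE.
    rewrite (@prod_elementary l k); last first.
      rewrite -lak; apply/eqP; rewrite -(eqn_add2r (\sum_(j < l) staircase j)%N).
      rewrite [X in (_ + X)%N == _](reindex_inj (@perm_inj _ t)) -!big_split.
      by apply/eqP/eq_bigr => j _ /=; rewrite subnK.
    apply: eq_bigr => s _; congr (_ * _%:R * _); apply: eq_card => f.
    rewrite !inE; congr andb; apply: eq_forallb => j.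
    by rewrite -(eqn_add2r (staircase (t j))) subnK.
  rewrite (bigD1 j) //= (_ : elementary _ = 0) ?mul0r ?mulr0; last first.
    have neg : (la j)%:Z - j%:Z + (t j)%:Z < 0.
      move: nj; rewrite /staircase.
      by have := ltn_ord j; have := ltn_ord (t j); lia.
    by case: (_ - _ + _) neg.
  rewrite big1 // => s _; rewrite /N eq_card0 ?mulr0 ?mul0r // => f.
  rewrite !inE; apply/negP => /andP[/forallP/(_ j)/eqP h _].
  by case/negP: nj; rewrite -h leq_addl.
rewrite exchange_big; apply: eq_bigr => s _ /=.
under eq_bigr do rewrite mulrA mulrCA.
rewrite -mulr_suml -mulr_sumr; congr (_ * _ * _).
by rewrite rmorph_sum; apply: eq_bigr => t _; rewrite rmorphM /= rmorph_sign.
Qed.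

End SchurDeterminant.

(** * Graded commutativity of the exterior algebra *)

Section GradedCommutativity.
Variables (K : comNzRingType) (m : nat).
Implicit Types (A B S : {set 'I_m}) (a b : ext K m).

Lemma ext_mulE a b S :
  (a * b) S = \sum_(A : {set 'I_m} | A \subset S)
     (-1) ^+ inversions A (S :\: A) * (a A * b (S :\: A)).
Proof. by rewrite ffunE. Qed.

Lemma ext_oneE S : (1 : ext K m) S = (S == set0)%:R.
Proof. by rewrite ffunE. Qed.

(** Every pair in A x B is an inversion in exactly one of the two orders. *)
Lemma inversions_swap A B : [disjoint A & B] ->
  (inversions A B + inversions B A)%N = (#|A| * #|B|)%N.
Proof.
move=> dAB; rewrite -cardsX {2}/inversions.
rewrite -(card_imset _ (f := fun u : 'I_m * 'I_m => (u.2, u.1))); last first.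
  by move=> [a b] [a' b'] [-> ->].
rewrite /inversions -cardsUI [X in (_ + X)%N](_ : _ = 0%N) ?addn0.
  apply: eq_card => -[a b]; rewrite !inE /=; apply/orP/andP.
    case=> [/and3P[-> ->]//|/imsetP[[a' b']]].
    by rewrite inE /= => /and3P[aB bA _] [-> ->].
  move=> [aA bB]; have [ab|ba|e] := ltngtP a b; first 1 last.
  - by left; rewrite aA bB.
  - by move: (disjointFr dAB aA); rewrite (val_inj e) bB.
  by right; apply/imsetP; exists (b, a); rewrite // inE /= bB aA.
apply: eq_card0 => -[a b]; rewrite !inE /=; apply/negP.
case/andP=> /and3P[_ _ ba] /imsetP[[a' b']]; rewrite inE /= => /and3P[_ _ ab].
by case=> ea eb; move: ba; rewrite ea eb ltnNge ltnW.
Qed.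

Lemma ext_mul_flip a b S :
  (b * a) S = \sum_(A : {set 'I_m} | A \subset S)
     (-1) ^+ (#|A| * #|S :\: A|) *
       ((-1) ^+ inversions A (S :\: A) * (a A * b (S :\: A))).
Proof.
have DD (A : {set 'I_m}) : A \subset S -> S :\: (S :\: A) = A.
  by move=> AS; rewrite setDDr setDv set0U (setIidPr AS).
rewrite ext_mulE (reindex_onto (fun A => S :\: A) (fun A => S :\: A)) /=; last first.
  exact: DD.
apply: eq_big => A.
  rewrite subsetDl /=; apply/eqP/idP => [<-|/DD //]; exact: subsetDl.
move=> /andP[_ /eqP AS]; rewrite AS mulrA -exprD [b _ * _]mulrC.
have dA : [disjoint A & S :\: A].
  by rewrite -setI_eq0 setIDA setIC -setIDA setDv setI0.
rewrite -(inversions_swap dA) addnAC addnn exprD.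
by rewrite -[(-1) ^+ _.*2]signr_odd odd_double mul1r.
Qed.

Definition homogeneous p a := forall S, a S != 0 -> #|S| = p.

Lemma ext_mul_homogeneous p q a b : homogeneous p a -> homogeneous q b ->
  b * a = (-1) ^+ (p * q) *: (a * b).
Proof.
move=> ha hb; apply/ffunP => S; rewrite ext_mul_flip ext_scaleE ext_mulE mulr_sumr.
apply: eq_bigr => A _.
have [->|/ha ->] := eqVneq (a A) 0; first by rewrite mul0r !mulr0.
have [->|/hb -> //] := eqVneq (b (S :\: A)) 0; first by rewrite !mulr0.
Qed.

Lemma ext_anticommute a b : homogeneous 1 a -> homogeneous 1 b ->
  a * b = - (b * a).
Proof.
by move=> ha hb; rewrite (ext_mul_homogeneous hb ha) expr1 scaleN1r.
Qed.

Definition even_form : {pred ext K m} :=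
  [pred a : ext K m | [forall S : {set 'I_m}, odd #|S| ==> (a S == 0)]].

Lemma even_formP a :
  reflect (forall S, odd #|S| -> a S = 0) (a \in even_form).
Proof.
apply: (iffP forallP) => [h S oS|h S]; first by apply/eqP; have /implyP := h S; apply.
by apply/implyP => /h/eqP.
Qed.

Lemma even_form_subring : subring_closed even_form.
Proof.
split=> [|a b /even_formP ha /even_formP hb|a b /even_formP ha /even_formP hb];
    apply/even_formP => S oS.
- by rewrite ext_oneE; case: eqP oS => // ->; rewrite cards0.
- by rewrite ffunE ha // ffunE hb // subr0.
rewrite ext_mulE big1 // => A AS; have := cardsD S A.
rewrite (setIidPr AS) => cD; have AS' := subset_leq_card AS.
have [oA|eA] := boolP (odd #|A|); first by rewrite ha // mul0r mulr0.
by rewrite hb ?mulr0 // cD oddB // oS (negPf eA).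
Qed.

HB.instance Definition _ := GRing.isSubringClosed.Build (ext K m) even_form
  even_form_subring.

Lemma even_form_comm a b : a \in even_form -> b \in even_form -> a * b = b * a.
Proof.
move=> /even_formP ha /even_formP hb; apply/ffunP => S.
rewrite [LHS]ext_mulE [RHS]ext_mul_flip; apply: eq_bigr => A _.
have [oA|eA] := boolP (odd #|A|); first by rewrite ha // mul0r !mulr0.
by rewrite -[(-1) ^+ (_ * _)]signr_odd oddM (negPf eA) mul1r.
Qed.

Lemma even_form_scale (t : K) a : a \in even_form -> t *: a \in even_form.
Proof.
move=> /even_formP ha; apply/even_formP => S oS.
by rewrite ext_scaleE ha ?mulr0.
Qed.

Lemma even_formM_odd a b : homogeneous 1 a -> homogeneous 1 b ->
  a * b \in even_form.
Proof.
move=> ha hb; apply/even_formP => S oS; rewrite ext_mulE big1 // => A AS.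
have [->|/ha eA] := eqVneq (a A) 0; first by rewrite mul0r mulr0.
have [->|/hb eD] := eqVneq (b (S :\: A)) 0; first by rewrite !mulr0.
have := cardsD S A; rewrite (setIidPr AS) eA eD => cS.
have := subset_leq_card AS; rewrite eA => /subnK; rewrite -cS => cS2.
by rewrite -cS2 in oS.
Qed.

(** Even forms commute, so that determinants of curvature matrices can be treated
   by commutative algebra. *)
Record even_ext := EvenExt { even_val :> ext K m; _ : even_val \in even_form }.

HB.instance Definition _ := [isSub for even_val].
HB.instance Definition _ := [Choice of even_ext by <:].
HB.instance Definition _ := [SubChoice_isSubNzRing of even_ext by <:].

Lemma even_extC : commutative (@GRing.mul even_ext).
Proof.
move=> a b; apply: val_inj; rewrite !rmorphM; exact: even_form_comm (valP a) (valP b).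
Qed.

HB.instance Definition _ := GRing.PzRing_hasCommutativeMul.Build even_ext even_extC.

HB.instance Definition _ := GRing.RMorphism.copy even_val
  (val : {rmorphism even_ext -> ext K m}).

End GradedCommutativity.

(** * Ordered products of anticommuting elements *)

Section AnticommutingProducts.
Variables (A : nzRingType).

Lemma anticommute_prod (T : eqType) (v : T -> A) (x : A) (s : seq T) :
  (forall p, x * v p = - (v p * x)) ->
  x * \prod_(p <- s) v p = (-1) ^+ size s * (\prod_(p <- s) v p * x).
Proof.
move=> xv; elim: s => [|p s IHs]; first by rewrite !big_nil mul1r mulr1 mul1r.
rewrite !big_cons mulrA xv mulNr -[X in - X]mulrA IHs exprS mulN1r mulNr.
rewrite -[(-1) ^+ size s]signr_odd.
by case: odd; rewrite ?expr1 ?expr0 ?mulN1r ?mul1r ?mulrN mulrA.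
Qed.

(** Exchanging two factors at distance d moves each of them past d - 1 others and
   then past each other: 2 d - 1 changes of sign. *)
Lemma anticommuting_prod_tperm k (v : 'I_k -> A) (i j : 'I_k) :
  (forall p q, v p * v q = - (v q * v p)) -> i != j ->
  \prod_p v (tperm i j p) = - \prod_p v p.
Proof.
move=> vC ij; pose e := index_enum 'I_k.
have ue : uniq e := index_enum_uniq _.
have [ie je] : i \in e /\ j \in e by rewrite !mem_index_enum.
suff H (a b : 'I_k) s1 s2 s3 : a != b -> e = s1 ++ a :: s2 ++ b :: s3 ->
    \prod_(p <- e) v (tperm a b p) = - \prod_(p <- e) v p.
  have split (x : 'I_k) s : x \in s -> exists s1 s2, s = s1 ++ x :: s2.
    by case/splitPr => s1 s2; exists s1, s2.
  have [s1 [s2 ee]] := split _ _ ie.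
  move: je; rewrite ee mem_cat in_cons eq_sym (negPf ij) /= => /orP[] /split[a [b es]].
    rewrite tpermC; apply: (H j i a b s2); first by rewrite eq_sym.
    by rewrite ee es -catA.
  by apply: (H i j s1 a b) => //; rewrite ee es.
move=> ab ee; move: ue; rewrite ee.
have fixed (s : seq 'I_k) : a \notin s -> b \notin s ->
    \prod_(p <- s) v (tperm a b p) = \prod_(p <- s) v p.
  move=> na nb; apply: eq_big_seq => p ps.
  by rewrite tpermD //; [apply: contraNneq na => ->|apply: contraNneq nb => ->].
have pe : perm_eq (s1 ++ a :: s2 ++ b :: s3) (a :: b :: s1 ++ s2 ++ s3).
  by apply/seq.permP => q; rewrite /= !count_cat /= !count_cat /=; lia.
rewrite (perm_uniq pe) /= !inE !mem_cat !negb_or.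
case/and3P=> /and4P[_ a1 a2 a3] /and3P[b1 b2 b3] _.
rewrite !big_cat !big_cons !big_cat !big_cons /= tpermL tpermR !fixed //.
rewrite -mulrN; congr (_ * _).
rewrite !mulrA -!mulNr; congr (_ * _).
rewrite !mulNr (anticommute_prod s2 (vC b)) (anticommute_prod s2 (vC a)).
by rewrite -!mulrA (vC b a) !mulrN.
Qed.

Lemma anticommuting_prod_perm k (v : 'I_k -> A) (s : 'S_k) :
  (forall p q, v p * v q = - (v q * v p)) ->
  \prod_p v (s p) = (-1) ^+ s * \prod_p v p.
Proof.
have [ts -> dts] := prod_tpermP s.
elim: ts v dts => [|[a b] ts IHts] v /= dts vC.
  by rewrite big_nil odd_perm1 mul1r; apply: eq_bigr => p _; rewrite perm1.
case/andP: dts => /= ab dts; rewrite big_cons odd_permM odd_tperm ab /=.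
under eq_bigr do rewrite permM.
rewrite (@anticommuting_prod_tperm k
  (fun p => v ((\prod_(t <- ts) tperm t.1 t.2)%g p)) a b) // IHts //.
by case: odd_perm; rewrite ?expr0 ?expr1 ?mulN1r ?mul1r ?opprK.
Qed.

(** To reach its place, u_p moves past p factors v, and 0 + 1 + ... + (k - 1) is
   'C(k, 2). *)
Lemma prod_interleave k (u v : 'I_k -> A) :
  (forall p q, v p * u q = - (u q * v p)) ->
  \prod_p (u p * v p) = (-1) ^+ 'C(k, 2) * (\prod_p u p * \prod_p v p).
Proof.
elim: k u v => [|k IHk] u v vu; first by rewrite !big_ord0 !mul1r.
rewrite !big_ord_recr IHk /=; last by move=> p q; apply: vu.
have vu' : forall p : 'I_k, u ord_max * v (widen_ord (leqnSn k) p) =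
    - (v (widen_ord (leqnSn k) p) * u ord_max) by move=> p; rewrite vu opprK.
have := anticommute_prod (index_enum 'I_k) vu'.
rewrite (_ : size _ = k); last by rewrite /index_enum -enumT size_enum_ord.
set U := \prod_(i < k) u _; set V := \prod_(i < k) v _ => h.
have -> : U * u ord_max * (V * v ord_max) =
    (-1) ^+ k * (U * V * (u ord_max * v ord_max)).
  rewrite mulrA -(mulrA U) h -[(-1) ^+ k]signr_odd.
  by case: odd; rewrite ?expr1 ?expr0 ?mulN1r ?mul1r ?mulrN ?mulNr ?opprK !mulrA.
by rewrite binS bin1 exprD -[RHS]mulrA signrMK !mulrA.
Qed.

End AnticommutingProducts.

(** * Bidegree and conjugation *)

From mathcomp Require Import reals complex ring.

Section Bidegree.
Variables (n : nat).
Implicit Types (A B S : {set 'I_(n + n)}).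

Definition holo_part S : {set 'I_n} := [set k | lshift n k \in S].
Definition antiholo_part S : {set 'I_n} := [set k | rshift n k \in S].

Lemma inversionsE m (A B : {set 'I_m}) :
  inversions A B = (\sum_x \sum_y [&& x \in A, y \in B & (y < x)%N])%N.
Proof.
rewrite pair_bigA /= /inversions -sum1dep_card big_mkcond.
by apply: eq_bigr => u _; case: [&& _, _ & _].
Qed.

(** The indices of the dz precede those of the dzbar: mixed pairs are never
   inverted in one order and always in the other. *)
Lemma inversions_split A B :
  inversions A B = (inversions (holo_part A) (holo_part B) +
    inversions (antiholo_part A) (antiholo_part B) + ahdeg A * hdeg B)%N.
Proof.
rewrite !inversionsE big_split_ord /=.
under eq_bigr do rewrite big_split_ord /=.
under [X in (_ + X)%N = _]eq_bigr do rewrite big_split_ord /=.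
rewrite !big_split /= [X in (_ + X + _)%N = _](_ : _ = 0%N); last first.
  rewrite big1 // => x _; rewrite big1 // => y _.
  by rewrite [(_ < _)%N]ltnNge /= (leq_trans (ltnW (ltn_ord x))) ?leq_addr ?andbF.
rewrite addn0 [X in (_ + X)%N = _]addnC addnA; congr (_ + _ + _)%N.
- by apply: eq_bigr => x _; apply: eq_bigr => y _; rewrite !inE.
- by apply: eq_bigr => x _; apply: eq_bigr => y _; rewrite !inE ltn_add2l.
rewrite /ahdeg /hdeg -cardsX -sum1_card (eq_bigl (fun u : 'I_n * 'I_n =>
   (rshift n u.1 \in A) && (lshift n u.2 \in B))); last by case=> x y; rewrite !inE.
rewrite -(pair_big (fun x => rshift n x \in A) (fun y => lshift n y \in B)
  (fun _ _ => 1%N)) /=.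
rewrite [RHS]big_mkcond; apply: eq_bigr => x _.
case: (rshift n x \in A); last by rewrite big1.
rewrite [RHS]big_mkcond; apply: eq_bigr => y _ /=.
rewrite (leq_trans (ltn_ord y)) ?leq_addr // andbT.
by case: (_ \in B).
Qed.

Lemma card_bidegree S : #|S| = (hdeg S + ahdeg S)%N.
Proof.
rewrite -sum1_card big_mkcond big_split_ord /= /hdeg /ahdeg -!sum1_card.
by congr addn; rewrite [RHS]big_mkcond; apply: eq_bigr => k _; rewrite inE.
Qed.

Lemma hdegD A S : A \subset S -> hdeg S = (hdeg A + hdeg (S :\: A))%N.
Proof.
move=> /subsetP AS; rewrite /hdeg -(cardsID [set k | lshift n k \in A]); congr addn.
  by apply: eq_card => k; rewrite !inE; apply/andP/idP => [[]//|kA]; split=> //; apply: AS.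
by apply: eq_card => k; rewrite !inE.
Qed.

Lemma ahdegD A S : A \subset S -> ahdeg S = (ahdeg A + ahdeg (S :\: A))%N.
Proof.
move=> /subsetP AS; rewrite /ahdeg -(cardsID [set k | rshift n k \in A]); congr addn.
  by apply: eq_card => k; rewrite !inE; apply/andP/idP => [[]//|kA]; split=> //; apply: AS.
by apply: eq_card => k; rewrite !inE.
Qed.

Lemma bar_lshift (k : 'I_n) : bar_index (lshift n k) = rshift n k.
Proof. by rewrite /bar_index -/(unsplit (inl _ k)) unsplitK. Qed.

Lemma bar_rshift (k : 'I_n) : bar_index (rshift n k) = lshift n k.
Proof. by rewrite /bar_index -/(unsplit (inr _ k)) unsplitK. Qed.

Lemma bar_indexK : involutive (@bar_index n).
Proof.
by move=> k; case: (split_ordP k) => j ->; rewrite !(bar_lshift, bar_rshift).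
Qed.

Definition bar_set S : {set 'I_(n + n)} := @bar_index n @^-1: S.

Lemma bar_setK : involutive bar_set.
Proof. by move=> S; apply/setP => k; rewrite !inE bar_indexK. Qed.

Lemma bar_setS A S : (bar_set A \subset bar_set S) = (A \subset S).
Proof.
have H (B C : {set 'I_(n + n)}) : B \subset C -> bar_set B \subset bar_set C.
  by move=> /subsetP h; apply/subsetP => k; rewrite !inE; apply: h.
by apply/idP/idP => [/H|/H //]; rewrite !bar_setK.
Qed.

Lemma bar_setD A S : bar_set S :\: bar_set A = bar_set (S :\: A).
Proof. by apply/setP => k; rewrite !inE. Qed.

Lemma bar_set0 : bar_set set0 = set0.
Proof. by apply/setP => k; rewrite !inE. Qed.

Lemma holo_part_bar S : holo_part (bar_set S) = antiholo_part S.
Proof. by apply/setP => k; rewrite !inE bar_lshift. Qed.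

Lemma antiholo_part_bar S : antiholo_part (bar_set S) = holo_part S.
Proof. by apply/setP => k; rewrite !inE bar_rshift. Qed.

Lemma hdeg_bar S : hdeg (bar_set S) = ahdeg S.
Proof. by rewrite /hdeg -/(holo_part _) holo_part_bar. Qed.

Lemma ahdeg_bar S : ahdeg (bar_set S) = hdeg S.
Proof. by rewrite /ahdeg -/(antiholo_part _) antiholo_part_bar. Qed.

(** The sign in the definition of [conj_ext] compensates for the exchange of the
   two blocks of indices, which is why conjugation is multiplicative. *)
Lemma inversions_bar A S : A \subset S ->
  odd (inversions (bar_set A) (bar_set (S :\: A)) + hdeg S * ahdeg S) =
  odd (inversions A (S :\: A) + hdeg A * ahdeg A +
       hdeg (S :\: A) * ahdeg (S :\: A)).
Proof.
move=> AS; rewrite (hdegD AS) (ahdegD AS) (inversions_split A).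
rewrite (inversions_split (bar_set A)) !holo_part_bar !antiholo_part_bar.
rewrite hdeg_bar ahdeg_bar.
move: (inversions _ _) (inversions _ _) => x y.
move: (hdeg A) (ahdeg A) (hdeg (S :\: A)) (ahdeg (S :\: A)) => a b c d.
rewrite mulnDl !mulnDr !oddD !oddM.
by case: (odd x); case: (odd y); case: (odd a); case: (odd b); case: (odd c); case: (odd d).
Qed.

End Bidegree.

Section Conjugation.
Variables (R : realType) (n : nat).
Local Notation C := R[i].
Local Notation Ext := (ext C (n + n)).
Implicit Types (a b : Ext).

Lemma conj_extE a S :
  conj_ext a S = (-1) ^+ (hdeg S * ahdeg S) * conjc (a (bar_set S)).
Proof. by rewrite ffunE. Qed.

Lemma conj_ext_is_zmod_morphism : zmod_morphism (@conj_ext R n).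
Proof.
by move=> a b; apply/ffunP => S; rewrite conj_extE !ffunE rmorphB mulrBr.
Qed.

Lemma conj_ext_is_monoid_morphism : monoid_morphism (@conj_ext R n).
Proof.
split=> [|a b]; apply/ffunP => S.
  rewrite conj_extE !ext_oneE.
  have -> : (bar_set S == set0) = (S == set0).
    by rewrite -[X in _ == X](bar_setK set0) (inj_eq (inv_inj (@bar_setK n))) bar_set0.
  case: eqP => [->|_]; last by rewrite conjc_nat mulr0.
  have -> : hdeg (set0 : {set 'I_(n + n)}) = 0%N.
    by apply: eq_card0 => k; rewrite !inE.
  by rewrite mul0n expr0 mul1r conjc_nat.
rewrite conj_extE !ext_mulE rmorph_sum /= mulr_sumr.
rewrite (reindex_inj (inv_inj (@bar_setK n))) /=.
apply: eq_big => A; first by rewrite bar_setS.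
rewrite bar_setS => AS; rewrite bar_setD !conj_extE !rmorphM /= rmorph_sign.
rewrite !mulrA -exprD addnC -signr_odd inversions_bar // signr_odd !exprD.
by congr (_ * _); rewrite mulrAC.
Qed.

HB.instance Definition _ := GRing.isZmodMorphism.Build Ext Ext (@conj_ext R n)
  conj_ext_is_zmod_morphism.
HB.instance Definition _ := GRing.isMonoidMorphism.Build Ext Ext (@conj_ext R n)
  conj_ext_is_monoid_morphism.

Lemma conj_ext_scale (t : C) a : conj_ext (t *: a) = conjc t *: conj_ext a.
Proof.
apply/ffunP => S; rewrite conj_extE !ext_scaleE conj_extE rmorphM.
by rewrite mulrCA.
Qed.

Lemma of_type_homogeneous a p q : of_type p q a -> homogeneous (p + q) a.
Proof. by move=> h S /h[<- <-]; rewrite card_bidegree. Qed.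

Lemma of_type_conj a p q : of_type p q a -> of_type q p (conj_ext a).
Proof.
move=> h S; rewrite conj_extE mulf_eq0 negb_or => /andP[_ nz].
have [|e1 e2] := h (bar_set S).
  by apply: contraNneq nz => ->; rewrite rmorph0.
by rewrite -hdeg_bar -ahdeg_bar.
Qed.

Lemma of_type1 : of_type 0 0 (1 : Ext).
Proof.
move=> S; rewrite ext_oneE; case: (eqVneq S set0) => [->|_] /=; last by rewrite eqxx.
by move=> _; split; apply: eq_card0 => k; rewrite !inE.
Qed.

Lemma of_type_mul a b p q p' q' : of_type p q a -> of_type p' q' b ->
  of_type (p + p') (q + q') (a * b).
Proof.
move=> ha hb S; rewrite ext_mulE => nz.
have [A AS h] : exists2 A : {set 'I_(n + n)}, A \subset S &
    a A * b (S :\: A) != 0.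
  apply/exists_inP; apply: contraNT nz => /exists_inPn h.
  by rewrite big1 // => A /h; rewrite negbK => /eqP ->; rewrite mulr0.
move: h; rewrite mulf_eq0 negb_or => /andP[/ha[<- <-] /hb[<- <-]].
by rewrite -hdegD // -ahdegD.
Qed.

Lemma of_typeD a b p q : of_type p q a -> of_type p q b -> of_type p q (a + b).
Proof.
move=> ha hb S; rewrite ffunE => nz.
have [a0|/ha //] := eqVneq (a S) 0; have [b0|/hb //] := eqVneq (b S) 0.
by rewrite a0 b0 addr0 eqxx in nz.
Qed.

Lemma of_typeZ t a p q : of_type p q a -> of_type p q (t *: a).
Proof.
by move=> ha S; rewrite ext_scaleE mulf_eq0 negb_or => /andP[_ /ha].
Qed.

Lemma of_type0 p q : of_type p q (0 : Ext).
Proof. by move=> S; rewrite ffunE eqxx. Qed.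

Lemma of_type_sum (I : finType) (P : pred I) (F : I -> Ext) p q :
  (forall i, P i -> of_type p q (F i)) -> of_type p q (\sum_(i | P i) F i).
Proof.
by move=> h; apply: big_ind => //; [apply: of_type0 | move=> *; apply: of_typeD].
Qed.

Lemma of_type_prod k (F : 'I_k -> Ext) : (forall i, of_type 1 0 (F i)) ->
  of_type k 0 (\prod_i F i).
Proof.
elim: k F => [|k IHk] F h; first by rewrite big_ord0; apply: of_type1.
rewrite big_ord_recl; apply: (@of_type_mul _ _ 1 0 k 0) => //; exact: IHk.
Qed.

End Conjugation.

(** * Positivity of the Frobenius expansion *)

Section Positivity.
Variables (R : realType) (n : nat).
Local Notation C := R[i].
Local Notation Ext := (ext C (n + n)).

(** The square root of a nonnegative factor is absorbed in the forms psi. *)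
Lemma strongly_nonnegative_sum (I : finType) (psi : I -> Ext) (d : R) p :
  0 <= d -> (forall i, of_type p 0 (psi i)) ->
  strongly_nonnegative p
    (('i%C ^+ (p ^ 2) * (d%:C)%C) *: \sum_i psi i * conj_ext (psi i)).
Proof.
move=> d0 tp; pose t : C := ((Num.sqrt d)%:C)%C.
exists #|I|, (fun j => t *: psi (enum_val j)); split.
  by move=> j; apply: of_typeZ.
rewrite -scalerA; congr (_ *: _); rewrite scaler_sumr.
rewrite (reindex (@enum_val I predT)); last exact/onW_bij/enum_val_bij.
apply: eq_bigr => j _ /=.
rewrite conj_ext_scale conjc_real -scalerAl -scalerAr scalerA.
by rewrite /t -rmorphM -expr2 sqr_sqrtr.
Qed.

Variables (r s k l : nat) (A : 'M[Ext]_(r, s)) (la : 'I_l -> nat).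
Hypothesis A10 : forall i j, of_type 1 0 (A i j).

Let Om (p q : 'I_r) : Ext := \sum_a A p a * conj_ext (A q a).
Let Psi (i : {ffun 'I_k -> 'I_r}) (a : {ffun 'I_k -> 'I_s}) : Ext :=
  \prod_p A (i p) (a p).

Let A1 i j : homogeneous 1 (A i j).
Proof. by have := of_type_homogeneous (@A10 i j). Qed.

Let cA1 i j : homogeneous 1 (conj_ext (A i j)).
Proof. by have := of_type_homogeneous (of_type_conj (@A10 i j)). Qed.

(** The (0,1)-factors are first moved to the right of the (1,0)-factors, and then
   put in the order of their first index, which costs the sign of g. *)
Let prod_curvature (i : {ffun 'I_k -> 'I_r}) (g : 'S_k) :
  \prod_p Om (i p) (i (g p)) =
  (-1) ^+ 'C(k, 2) * ((-1) ^+ g * \sum_a Psi i a * conj_ext (Psi i (word_act a g))).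
Proof.
rewrite /Om bigA_distr_bigA !mulr_sumr; apply: eq_bigr => a _.
rewrite prod_interleave; last by move=> p q; apply: ext_anticommute.
congr (_ * _); rewrite -/(Psi i a).
pose v q := conj_ext (A (i q) (a ((g^-1)%g q))).
have -> : \prod_p conj_ext (A (i (g p)) (a p)) = \prod_p v (g p).
  by apply: eq_bigr => p _; rewrite /v permK.
rewrite anticommuting_prod_perm; last first.
  by move=> p q; apply: ext_anticommute; apply: cA1.
have -> : \prod_p v p = conj_ext (Psi i (word_act a g)).
  by rewrite rmorph_prod; apply: eq_bigr => p _; rewrite /v ffunE.
by case: odd_perm; rewrite ?expr1 ?expr0 ?mulN1r ?mul1r ?mulrN.
Qed.

Let phi := @schur_character l k la.
Hypothesis la_sorted : forall i j : 'I_l, (i <= j)%N -> (la j <= la i)%N.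
Hypothesis la_sum : (\sum_j la j)%N = k.

(* Psi averaged against the character, acting on the second word. *)
Let Psi' i a : Ext := \sum_(g : 'S_k) (phi g)%:~R *: Psi i (word_act a g).

Let conj_Psi' i a : conj_ext (Psi' i a) =
  \sum_(g : 'S_k) (phi g)%:~R *: conj_ext (Psi i (word_act a g)).
Proof.
rewrite rmorph_sum; apply: eq_bigr => g _.
by rewrite /= conj_ext_scale rmorph_int.
Qed.

(** The character is real and invariant under inversion, so expanding the product
   on the left gives its convolution with itself, a multiple of the character. *)
Let isotypic_projection i :
  (phi 1%g)%:~R *: \sum_a Psi' i a * conj_ext (Psi' i a) =
  k`!%:R *: \sum_(g : 'S_k) (phi g)%:~R *:
     \sum_a Psi i a * conj_ext (Psi i (word_act a g)).
Proof.
have actM a (g h : 'S_k) : word_act a (g * h) = word_act (word_act a g) h.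
  exact: (actM (word_action k _)).
have actI (g : 'S_k) : bijective (fun a : {ffun 'I_k -> 'I_s} => word_act a g).
  exists (fun a => word_act a g^-1).
    exact: (actK (word_action k _)).
  exact: (actKV (word_action k _)).
rewrite [RHS]scaler_sumr.
have conv (g : 'S_k) : k`!%:R * (phi g)%:~R = (phi 1%g)%:~R *
    \sum_(x : 'S_k) (phi (x * g)%g)%:~R * (phi x)%:~R :> C.
  rewrite -[k`!%:R](_ : (k`!%:Z)%:~R = _) // -rmorphM.
  rewrite -schur_character_convolution // rmorphM; congr (_ * _).
  by rewrite [LHS]rmorph_sum; apply: eq_bigr => x _; rewrite rmorphM.
under [RHS]eq_bigr => g _ do rewrite scalerA conv -scalerA scaler_suml.
rewrite /= -scaler_sumr; congr (_ *: _).
under eq_bigr => a _ do rewrite conj_Psi' mulr_suml.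
rewrite exchange_big [RHS]exchange_big; apply: eq_bigr => x _ /=.
rewrite (reindex_inj (bij_inj (actI x^-1)))%g /=.
under eq_bigr => a _ do rewrite mulr_sumr.
rewrite exchange_big (reindex_inj (mulgI x)) /=; apply: eq_bigr => g _.
rewrite scaler_sumr; apply: eq_bigr => a _.
rewrite -!actM mulVg mulKg -scalerAl -scalerAr scalerA mulrC.
by rewrite (_ : word_act a 1 = a) //; apply: (act1 (word_action k _)).
Qed.

(** By [isotypic_projection] the double sum is a positive multiple of
   the sum of Psi' conj(Psi').  The powers of i match because
   i^k (-1)^('C(k, 2)) = i^(k + 2 'C(k, 2)) = i^(k^2). *)
Lemma schur_expansion_strongly_nonnegative (d : R) : 0 <= d ->
  strongly_nonnegative k ((k`!%:R)^-1 *: \sum_(g : 'S_k)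
    (-1) ^+ g * (phi g)%:~R * \sum_(i : {ffun 'I_k -> 'I_r})
      \prod_p ((0 +i* d)%C *: Om (i p) (i (g p)))).
Proof.
move=> d0.
have kf : k`!%:R != 0 :> C by rewrite pnatr_eq0 -lt0n fact_gt0.
have phi1 : 0 < phi 1%g by apply: schur_character1_gt0.
pose e : R := d ^+ k * (phi 1%g)%:~R / (k`!%:R) ^+ 2.
have e0 : 0 <= e.
  by rewrite divr_ge0 ?exprn_ge0 // mulr_ge0 ?exprn_ge0 // ler0z ltW.
pose psi (ia : {ffun 'I_k -> 'I_r} * {ffun 'I_k -> 'I_s}) := Psi' ia.1 ia.2.
rewrite [X in strongly_nonnegative _ X](_ : _ =
    ('i%C ^+ (k ^ 2) * (e%:C)%C) *: \sum_ia psi ia * conj_ext (psi ia)).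
  apply: strongly_nonnegative_sum => // -[i a]; apply: of_type_sum => g _.
  by apply: of_typeZ; apply: of_type_prod.
rewrite /psi -(pair_bigA _ (fun i a => Psi' i a * conj_ext (Psi' i a))) /=.
pose c : C := (0 +i* d)%C.
have prodE (g : 'S_k) (i : {ffun 'I_k -> 'I_r}) :
    \prod_p (c *: Om (i p) (i (g p))) = c ^+ k *: ((-1) ^+ 'C(k, 2) * ((-1) ^+ g *
      \sum_a Psi i a * conj_ext (Psi i (word_act a g)))).
  rewrite -prod_curvature scaler_prod prodr_const.
  by rewrite [#|_|]card_ord.
pose Y := \sum_(i : {ffun 'I_k -> 'I_r}) \sum_(g : 'S_k) (phi g)%:~R *:
  \sum_a Psi i a * conj_ext (Psi i (word_act a g)).
have -> : \sum_(g : 'S_k) (-1) ^+ g * (phi g)%:~R * \sum_(i : {ffun 'I_k -> 'I_r})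
    \prod_p (c *: Om (i p) (i (g p))) = (c ^+ k * (-1) ^+ 'C(k, 2)) *: Y.
  rewrite /Y exchange_big scaler_sumr; apply: eq_bigr => g _ /=.
  rewrite scaler_sumr mulr_sumr; apply: eq_bigr => i _; rewrite prodE.
  move: (\sum_a _) => X; rewrite -scalerAr -scalerA; congr (_ *: _).
  have signZ j (x : Ext) : (-1) ^+ j *: x = (-1) ^+ j * x.
    rewrite -[in LHS]signr_odd -[in RHS]signr_odd.
    by case: odd; rewrite ?expr1 ?expr0 ?scaleN1r ?scale1r ?mulN1r ?mul1r.
  have signC j (x y : Ext) : x * ((-1) ^+ j * y) = (-1) ^+ j * (x * y).
    by rewrite !mulrA (commr_sign x j).
  rewrite signZ scaler_int -(mulrzl X) [LHS]signC; congr (_ * _).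
  by rewrite -mulrA (signC _ (phi g)%:~R) signrMK.
have YE : (phi 1%g)%:~R *: (\sum_i \sum_a Psi' i a * conj_ext (Psi' i a)) =
    k`!%:R *: Y :> Ext.
  by rewrite /Y !scaler_sumr; apply: eq_bigr => i _; apply: isotypic_projection.
have {}YE : Y = ((k`!%:R)^-1 * (phi 1%g)%:~R) *:
    (\sum_i \sum_a Psi' i a * conj_ext (Psi' i a)).
  by rewrite -scalerA YE scalerA mulVf // scale1r.
rewrite YE !scalerA; congr (_ *: _).
have -> : (e%:C)%C = ((d%:C)%C ^+ k * (phi 1%g)%:~R / k`!%:R ^+ 2) :> C.
  by rewrite /e !rmorphM rmorph_int !rmorphXn fmorphV rmorphXn rmorph_nat.
have -> : c = 'i%C * (d%:C)%C.
  by rewrite /c; simpc.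
have sqrE j : (j ^ 2 = j + 2 * 'C(j, 2))%N.
  by elim: j => // j IHj; rewrite binS bin1; move: IHj; rewrite -!mulnn; lia.
rewrite sqrE exprD exprM sqr_i exprMn expr2 invfM.
by rewrite !mulrA; ring.
Qed.

End Positivity.

(** * Symmetry of second derivatives *)

From mathcomp Require Import all_classical all_reals all_analysis.
From mathcomp Require Import lra.
Import numFieldNormedType.Exports.

Local Open Scope classical_set_scope.
Local Open Scope ring_scope.

Section Schwarz.
Variables (R : realType) (V : normedModType R).
Implicit Types (u : V -> R) (x y e f v : V).

Lemma is_derive_slice u y v (s : R) : derivable u (s *: v + y) v ->
  is_derive s 1 (fun t => u (t *: v + y)) ('D_v u (s *: v + y)).
Proof.
have E : (fun h : R => h^-1 *: (((fun t => u (t *: v + y)) \o shift s) (h *: 1)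
      - u (s *: v + y))) =
    (fun h => h^-1 *: ((u \o shift (s *: v + y)) (h *: v) - u (s *: v + y))).
  apply/funext => h; congr (_ *: (_ - _)); rewrite /= -[h%:A]/(h * 1) mulr1.
  by congr u; rewrite scalerDl addrA.
move=> du; apply: DeriveDef; first by rewrite /derivable E.
by rewrite /derive E.
Qed.

Lemma mean_value_slice u y v (h : R) : 0 < h ->
  (forall s, 0 <= s <= h -> derivable u (s *: v + y) v) ->
  exists2 s, 0 <= s <= h & u (h *: v + y) - u y = h * 'D_v u (s *: v + y).
Proof.
move=> h0 du; pose g t := u (t *: v + y).
have dg s : s \in `[0, h]%R -> is_derive s 1 g ('D_v u (s *: v + y)).
  by rewrite in_itv /= => /du; apply: is_derive_slice.
have dgo s : s \in `]0, h[%R -> is_derive s 1 g ('D_v u (s *: v + y)).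
  by move=> sh; apply: dg; apply: subset_itv_oo_cc sh.
have cg : {within `[0, h], continuous g}.
  by apply: derivable_within_continuous => s /dg [].
have [s] := MVT h0 dgo cg; rewrite in_itv /= => /andP[s0 sh].
rewrite /g scale0r add0r subr0 mulrC => E.
by exists s; rewrite ?(ltW s0) ?(ltW sh).
Qed.

(** The mean value theorem, applied in the direction e to the difference
   u (_ + h f) - u, and then in the direction f to the derivative along e. *)
Lemma second_difference u x e f (h : R) : 0 < h ->
  (forall s t, 0 <= s <= h -> 0 <= t <= h ->
     derivable u (s *: e + (t *: f + x)) e /\
     derivable ('D_e u) (s *: e + (t *: f + x)) f) ->
  exists s t, [/\ 0 <= s <= h, 0 <= t <= h &
    u (h *: e + (h *: f + x)) - u (h *: f + x) - (u (h *: e + x) - u x) =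
    h ^+ 2 * 'D_f ('D_e u) (s *: e + (t *: f + x))].
Proof.
move=> h0 du; have hh : 0 <= h <= h by rewrite lexx ltW.
have h00 : 0 <= (0 : R) <= h by rewrite lexx ltW.
pose w y := u (h *: f + y) - u y.
have dw s : 0 <= s <= h -> is_derive s 1 (fun t => w (t *: e + x))
    ('D_e u (s *: e + (h *: f + x)) - 'D_e u (s *: e + x)).
  move=> sh; have d1 := (du s h sh hh).1; have d0 := (du s 0 sh h00).1.
  rewrite scale0r add0r in d0.
  have -> : (fun t => w (t *: e + x)) =
      (fun t => u (t *: e + (h *: f + x))) - (fun t => u (t *: e + x)).
    by apply/funext => t; rewrite /w /= addrCA.
  exact: is_deriveB (is_derive_slice d1) (is_derive_slice d0).
have dwo s : s \in `]0, h[%R -> is_derive s 1 (fun t => w (t *: e + x))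
    ('D_e u (s *: e + (h *: f + x)) - 'D_e u (s *: e + x)).
  by move=> sh; apply: dw; have := subset_itv_oo_cc sh; rewrite in_itv.
have cw : {within `[0, h], continuous (fun t => w (t *: e + x))}.
  by apply: derivable_within_continuous => s; rewrite in_itv /= => /dw [].
have [s] := MVT h0 dwo cw; rewrite in_itv /= => /andP[s0 sh].
have sI : 0 <= s <= h by rewrite (ltW s0) (ltW sh).
rewrite scale0r add0r subr0 => E.
have [|t tI Et] := @mean_value_slice ('D_e u) (s *: e + x) f h h0.
  by move=> t tI; rewrite addrCA; apply: (du s t sI tI).2.
exists s, t; split; [exact: sI | exact: tI |].
rewrite [h *: e + (h *: f + x)]addrCA.
transitivity (w (h *: e + x) - w x); first by rewrite /w; lra.
rewrite E.
rewrite [s *: e + (h *: f + x)]addrCA Et [s *: e + (t *: f + x)]addrCA.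
by rewrite expr2 mulrC mulrA.
Qed.

(** The second difference is symmetric in e and f; so, arbitrarily near x, a value
   of one mixed derivative equals a value of the other. *)
Lemma schwarz u x e f :
  (\forall y \near x, [/\ derivable u y e, derivable u y f,
     derivable ('D_e u) y f & derivable ('D_f u) y e]) ->
  {for x, continuous ('D_f ('D_e u))} -> {for x, continuous ('D_e ('D_f u))} ->
  'D_f ('D_e u) x = 'D_e ('D_f u) x.
Proof.
move=> du c1 c2; apply/eqP; apply/negPn/negP => ne.
set a := 'D_f ('D_e u) x in ne; set b := 'D_e ('D_f u) x in ne.
pose eps := `|a - b| / 2.
have eps0 : 0 < eps by rewrite divr_gt0 // normr_gt0 subr_eq0.
have near1 : nbhs x (fun y : V => [/\ [/\ derivable u y e, derivable u y f,
     derivable ('D_e u) y f & derivable ('D_f u) y e],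
     `|a - 'D_f ('D_e u) y| < eps & `|b - 'D_e ('D_f u) y| < eps]).
  move/cvgrPdist_lt: c1 => /(_ _ eps0) n1.
  move/cvgrPdist_lt: c2 => /(_ _ eps0) n2.
  have FF : Filter (nbhs x) by typeclasses eauto.
  apply: (@filterS _ _ FF _ _ _ (@filterI _ _ FF _ _ du (@filterI _ _ FF _ _ n1 n2))).
  move=> y [h [h1 h2]]; split; [exact: h | exact: h1 | exact: h2].
have /nbhs_ballP[d /= d0 dsub] := near1.
pose N := `|e| + `|f| + 1.
have N0 : 0 < N by rewrite /N ltr_wpDl // addr_ge0.
pose h := d / 2 / N.
have h0 : 0 < h by rewrite !divr_gt0.
have box s t : 0 <= s <= h -> 0 <= t <= h -> ball x d (s *: e + (t *: f + x)).
  move=> /andP[s0 sh] /andP[t0 th]; rewrite -ball_normE /ball_ /= addrA.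
  rewrite opprD addrCA subrr addr0 normrN.
  apply: (le_lt_trans (ler_normD _ _)); rewrite !normrZ !ger0_norm //.
  apply: (@le_lt_trans _ _ (h * N)); last first.
    by rewrite /h divfK ?gt_eqF // ltr_pdivrMr // ltr_pMr // ltr1n.
  rewrite /N !mulrDr; have := ler_wpM2r (normr_ge0 e) sh.
  by have := ler_wpM2r (normr_ge0 f) th; rewrite mulr1; lra.
have [|s1 [t1 [s1I t1I E1]]] := @second_difference u x e f h h0.
  move=> s t sI tI; have [[d1 _ d3 _] _ _] := dsub _ (box s t sI tI).
  by split; [exact: d1 | exact: d3].
have [|s2 [t2 [s2I t2I E2]]] := @second_difference u x f e h h0.
  move=> s t sI tI; rewrite addrCA; have [[_ d2 _ d4] _ _] := dsub _ (box t s tI sI).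
  by split; [exact: d2 | exact: d4].
have E : 'D_f ('D_e u) (s1 *: e + (t1 *: f + x)) =
         'D_e ('D_f u) (t2 *: e + (s2 *: f + x)).
  apply: (@mulfI _ (h ^+ 2)); first by rewrite expf_neq0 // gt_eqF.
  rewrite -E1 [t2 *: e + _]addrCA -E2 [h *: f + (h *: e + x)]addrCA.
  move: (u _) (u (h *: f + x)) (u (h *: e + x)) (u x) => p q v z; ring.
have [_ h1 _] := dsub _ (box _ _ s1I t1I).
have [_ _ h2] := dsub _ (box _ _ t2I s2I).
move: h1; rewrite E; move: ('D_e ('D_f u) _) h2 => c h2 h1.
suff : `|a - b| < eps + eps by rewrite /eps -splitr ltxx.
apply: le_lt_trans (ler_distD c a b) _.
by apply: ltrD; [exact: h1 | rewrite distrC; exact: h2].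
Qed.

End Schwarz.

(** * Exterior differentiation in real coordinates *)

(** With a, b for dz, dzbar and P, Q for the derivatives in x, y: the identity
   between the expressions of d in complex and in real coordinates. *)
Lemma wirtinger_expansion (K : comNzRingType) (A : algType K) (h t : K)
    (a b P Q : A) :
  a * (h *: (P - t *: Q)) + b * (h *: (P + t *: Q)) =
  h *: (a + b) * P + (h * t) *: (b - a) * Q.
Proof.
rewrite -!scalerAr -!scalerAl -scalerA -!scalerDr; congr (_ *: _).
rewrite mulrBr mulrDr mulrDl mulrBl scalerBr -!scalerAr.
by rewrite addrACA [- _ + _]addrC.
Qed.

Section PartialDerivatives.
Variables (R : realType) (n : nat).
Local Notation C := R[i].
Local Notation V := 'rV[R]_(n + n).
Local Notation Ext := (ext C (n + n)).
Implicit Types (k : 'I_(n + n)) (f g : V -> C) (x : V) (w : V -> Ext).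

Definition cderivable k f x : Prop :=
  derivable (fun y => complex.Re (f y)) x (delta_mx ord0 k) /\
  derivable (fun y => complex.Im (f y)) x (delta_mx ord0 k).

Lemma partialD k f g x : cderivable k f x -> cderivable k g x ->
  cderivable k (fun y => f y + g y) x /\
  partial k (fun y => f y + g y) x = partial k f x + partial k g x.
Proof.
move=> [rf imf] [rg img].
have eR : (fun y => complex.Re (f y + g y)) =
    (fun y => complex.Re (f y)) + (fun y => complex.Re (g y)).
  by apply/funext => y; rewrite fctE; case: (f y) (g y) => a b [c d].
have eI : (fun y => complex.Im (f y + g y)) =
    (fun y => complex.Im (f y)) + (fun y => complex.Im (g y)).
  by apply/funext => y; rewrite fctE; case: (f y) (g y) => a b [c d].
split.
  rewrite /cderivable eR eI.
  by split; [exact: (derivableD rf rg) | exact: (derivableD imf img)].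
by rewrite /partial /rpartial eR eI (deriveD rf rg) (deriveD imf img).
Qed.

Lemma complex_leibniz (z t : C) (p q u v : R) :
  ((complex.Re z *: u + complex.Re t *: p - (complex.Im z *: v + complex.Im t *: q))
   +i* (complex.Re z *: v + complex.Im t *: p + (complex.Im z *: u + complex.Re t *: q)))%C
  = (p +i* q)%C * t + z * (u +i* v)%C.
Proof.
case: z t => a b [c d]; rewrite /GRing.scale /=; simpc.
by congr (_ +i* _)%C; ring.
Qed.

Lemma partialM k f g x : cderivable k f x -> cderivable k g x ->
  cderivable k (fun y => f y * g y) x /\
  partial k (fun y => f y * g y) x = partial k f x * g x + f x * partial k g x.
Proof.
move=> [rf imf] [rg img].
pose rf' := (fun y => complex.Re (f y)); pose if' := (fun y => complex.Im (f y)).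
pose rg' := (fun y => complex.Re (g y)); pose ig' := (fun y => complex.Im (g y)).
have eR : (fun y => complex.Re (f y * g y)) = rf' * rg' - if' * ig'.
  by apply/funext => y /=; rewrite !fctE /rf' /rg' /if' /ig'; case: (f y) (g y) => a b [c d].
have eI : (fun y => complex.Im (f y * g y)) = rf' * ig' + if' * rg'.
  by apply/funext => y /=; rewrite !fctE /rf' /rg' /if' /ig'; case: (f y) (g y) => a b [c d].
have d1 : derivable (rf' * rg') x (delta_mx ord0 k) := derivableM rf rg.
have d2 : derivable (if' * ig') x (delta_mx ord0 k) := derivableM imf img.
have d3 : derivable (rf' * ig') x (delta_mx ord0 k) := derivableM rf img.
have d4 : derivable (if' * rg') x (delta_mx ord0 k) := derivableM imf rg.
split.
  rewrite /cderivable eR eI.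
  by split; [exact: (derivableB d1 d2) | exact: (derivableD d3 d4)].
rewrite /partial /rpartial eR eI (deriveB d1 d2) (deriveD d3 d4).
rewrite (deriveM rf rg) (deriveM imf img) (deriveM rf img) (deriveM imf rg).
exact: complex_leibniz.
Qed.

Lemma partial_cst k (c : C) x :
  cderivable k (fun=> c) x /\ partial k (fun=> c) x = 0.
Proof.
split; first by split; apply: derivable_cst.
by rewrite /partial /rpartial !derive_cst.
Qed.

Definition form_derivable k w x : Prop :=
  forall S, cderivable k (fun y => w y S) x.

Definition form_partial k w x : Ext := coefwise (partial k) w x.

Lemma form_partialE k w x S : form_partial k w x S = partial k (fun y => w y S) x.
Proof. by rewrite ffunE. Qed.

Lemma form_partialD k w w' x : form_derivable k w x -> form_derivable k w' x ->
  form_derivable k (fun y => w y + w' y) x /\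
  form_partial k (fun y => w y + w' y) x = form_partial k w x + form_partial k w' x.
Proof.
move=> dw dw'.
have e S : (fun y => (w y + w' y) S) = (fun y => w y S + w' y S).
  by apply/funext => y; rewrite ffunE.
split; first by move=> S; rewrite e; exact: (partialD (dw S) (dw' S)).1.
apply/ffunP => S; rewrite form_partialE e (partialD (dw S) (dw' S)).2.
by rewrite ext_addE !form_partialE.
Qed.

Lemma form_partialZ k g w x : cderivable k g x -> form_derivable k w x ->
  form_derivable k (fun y => g y *: w y) x /\
  form_partial k (fun y => g y *: w y) x =
    partial k g x *: w x + g x *: form_partial k w x.
Proof.
move=> dg dw.
have e S : (fun y => (g y *: w y) S) = (fun y => g y * w y S).
  by apply/funext => y; rewrite ext_scaleE.
split; first by move=> S; rewrite e; exact: (partialM dg (dw S)).1.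
apply/ffunP => S; rewrite form_partialE e (partialM dg (dw S)).2 ext_addE.
by rewrite !ext_scaleE form_partialE.
Qed.

Lemma form_partial_cst k (a : Ext) x :
  form_derivable k (fun=> a) x /\ form_partial k (fun=> a) x = 0.
Proof.
split; first by move=> S; apply: (partial_cst _ _ _).1.
by apply/ffunP => S; rewrite ffunE (partial_cst _ _ _).2 ffunE.
Qed.

Lemma form_partial_sum k (I : Type) (s : seq I) (W : I -> V -> Ext) x :
  (forall i, form_derivable k (W i) x) ->
  form_derivable k (fun y => \sum_(i <- s) W i y) x /\
  form_partial k (fun y => \sum_(i <- s) W i y) x =
    \sum_(i <- s) form_partial k (W i) x.
Proof.
move=> dW; elim: s => [|i s [dS eS]].
  rewrite big_nil (_ : (fun y => _) = fun=> 0); first exact: form_partial_cst.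
  by apply/funext => y; rewrite big_nil.
rewrite big_cons (_ : (fun y => _) = fun y => W i y + \sum_(j <- s) W j y).
  by rewrite -eS; exact: form_partialD (dW i) dS.
by apply/funext => y; rewrite big_cons.
Qed.

(** dx_k and dy_k; with these, d has constant coefficients and one term for each
   real coordinate. *)
Definition real_coframe k : Ext :=
  match fintype.split k with
  | inl j => 2^-1 *: (gen C (lshift n j) + gen C (rshift n j))
  | inr j => (2^-1 * 'i%C) *: (gen C (rshift n j) - gen C (lshift n j))
  end.

Lemma real_coframe_homogeneous k : homogeneous 1 (real_coframe k).
Proof.
have hg (j : 'I_(n + n)) : homogeneous 1 (gen C j).
  move=> S; rewrite ffunE; case: (eqVneq S [set j]%SET) => [-> _|_ /eqP //].
  by rewrite cards1.
have hD (a b : Ext) : homogeneous 1 a -> homogeneous 1 b -> homogeneous 1 (a + b).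
  move=> ha hb S; rewrite ext_addE.
  by have [->|/ha //] := eqVneq (a S) 0; rewrite add0r => /hb.
have hZ (t : C) (a : Ext) : homogeneous 1 a -> homogeneous 1 (t *: a).
  by move=> ha S; rewrite ext_scaleE mulf_eq0 negb_or => /andP[_ /ha].
rewrite /real_coframe; case: fintype.split => j; apply: (hZ); apply: (hD) => //.
by rewrite -scaleN1r; apply: (hZ).
Qed.

Lemma real_coframe_anticommute k l :
  real_coframe k * real_coframe l = - (real_coframe l * real_coframe k).
Proof. by apply: ext_anticommute; apply: real_coframe_homogeneous. Qed.

Lemma dext_coframe w x :
  dext w x = \sum_k real_coframe k * form_partial k w x.
Proof.
rewrite [RHS]big_split_ord /= -big_split; apply: eq_bigr => j _ /=.
rewrite /real_coframe -/(unsplit (inl _ j)) -/(unsplit (inr _ j)) !unsplitK /=.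
set P := form_partial _ w x; set Q := form_partial _ w x.
have -> : coefwise (dz j) w x = 2^-1 *: (P - 'i%C *: Q).
  by apply/ffunP => S; rewrite !ffunE.
have -> : coefwise (dzbar j) w x = 2^-1 *: (P + 'i%C *: Q).
  by apply/ffunP => S; rewrite !ffunE.
move: (gen C _) (gen C _) => a b.
exact: wirtinger_expansion.
Qed.

Lemma form_partial_alg k (g : V -> C) x :
  form_partial k (fun y => (g y)%:A : Ext) x = (partial k g x)%:A.
Proof.
apply/ffunP => S; rewrite form_partialE ext_scaleE ext_oneE.
have -> : (fun y => ((g y)%:A : Ext) S) = (fun y => g y * (S == finset.set0)%:R).
  by apply/funext => y; rewrite ext_scaleE ext_oneE.
case: (S == _).
  have -> : (fun y => g y * true%:R) = g by apply/funext => y; rewrite mulr1.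
  by rewrite mulr1.
have -> : (fun y => g y * false%:R) = fun=> 0 by apply/funext => y; rewrite mulr0.
by rewrite (partial_cst k 0 x).2 mulr0.
Qed.

Lemma smooth_cderivable W f x k : smooth_on W f -> W x -> cderivable k f x.
Proof.
by move=> [rf imf] Wx; split; [apply: (rf [::] x Wx).2 | apply: (imf [::] x Wx).2].
Qed.

Lemma smooth_partial_cderivable W f x k l : smooth_on W f -> W x ->
  cderivable k (partial l f) x.
Proof.
move=> [rf imf] Wx.
by split; [exact: ((rf [:: l] x Wx).2 k) | exact: ((imf [:: l] x Wx).2 k)].
Qed.

(** Symmetry of second derivatives needs a neighborhood of x on which u is
   smooth. *)
Lemma rsmooth_partial_comm W (u : V -> R) x k l : nbhs x W ->
  rsmooth_on W u -> rpartial k (rpartial l u) x = rpartial l (rpartial k u) x.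
Proof.
move=> Wx su; have x_W := nbhs_singleton Wx.
have FF : Filter (nbhs x) by typeclasses eauto.
apply: (@schwarz R V u x (delta_mx ord0 l) (delta_mx ord0 k)).
- apply: (@filterS _ _ FF _ _ _ Wx) => y Wy.
  split; [exact: (su [::] y Wy).2 | exact: (su [::] y Wy).2 |
          exact: (su [:: l] y Wy).2 | exact: (su [:: k] y Wy).2].
- exact: (su [:: k; l] x x_W).1.
- exact: (su [:: l; k] x x_W).1.
Qed.

Lemma partial_comm W f x k l : nbhs x W -> smooth_on W f ->
  partial k (partial l f) x = partial l (partial k f) x.
Proof.
move=> Wx [rf imf].
have e1 := rsmooth_partial_comm k l Wx rf.
have e2 := rsmooth_partial_comm k l Wx imf.
rewrite [LHS]/partial [RHS]/partial.
transitivity (rpartial k (rpartial l (fun y => complex.Re (f y))) x +i*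
  rpartial k (rpartial l (fun y => complex.Im (f y))) x)%C; first by [].
by rewrite e1 e2.
Qed.

Lemma dext_scalar (g : V -> C) y :
  dext (fun z => (g z)%:A : Ext) y = \sum_l partial l g y *: real_coframe l.
Proof.
rewrite dext_coframe; apply: eq_bigr => l _.
by rewrite form_partial_alg mulr_algr.
Qed.

Lemma dext_scalar_derivable W (g : V -> C) x k : smooth_on W g -> W x ->
  form_derivable k (dext (fun z => (g z)%:A : Ext)) x /\
  form_partial k (dext (fun z => (g z)%:A : Ext)) x =
    \sum_l partial k (partial l g) x *: real_coframe l.
Proof.
move=> sg Wx.
rewrite (_ : dext _ = fun y => \sum_l partial l g y *: real_coframe l); last first.
  by apply/funext => y; apply: dext_scalar.
have dl l := form_partialZ (smooth_partial_cderivable k l sg Wx)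
  (form_partial_cst k (real_coframe l) x).1.
have [|d ->] := @form_partial_sum k _ (index_enum 'I_(n + n))
  (fun l y => partial l g y *: real_coframe l) x.
  by move=> l; apply: (dl l).1.
split; first exact: d.
apply: eq_bigr => l _; rewrite (dl l).2.
by rewrite (form_partial_cst _ _ _).2 scaler0 addr0.
Qed.

(** Second derivatives are symmetric while the dx_k anticommute. *)
Lemma dext_dext_scalar W (g : V -> C) x : nbhs x W -> smooth_on W g ->
  dext (dext (fun z => (g z)%:A : Ext)) x = 0.
Proof.
move=> nW sg; have Wx := nbhs_singleton nW.
rewrite dext_coframe.
under eq_bigr => k _ do rewrite (dext_scalar_derivable k sg Wx).2 mulr_sumr.
set S := (X in X = 0).
have SN : S = - S.
  rewrite {1}/S exchange_big -sumrN; apply: eq_bigr => k _ /=.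
  rewrite -sumrN; apply: eq_bigr => l _ /=.
  rewrite -(scalerAr _ (real_coframe l)) -(scalerAr _ (real_coframe k)).
  rewrite (real_coframe_anticommute l k).
  rewrite (partial_comm l k nW sg).
  move: (partial k _ x) (_ * _) => a b.
  exact: scalerN.
have /eqP : S + S = 0 by rewrite {1}SN addNr.
rewrite -mulr2n -scaler_nat => /eqP h.
apply: (scalerI (a := (2%:R : C))); first by rewrite pnatr_eq0.
by rewrite h scaler0.
Qed.

(** Leibniz' rule with the function on the right: dx_k moves past the 1-form w. *)
Lemma dext_mul_scalar (w : V -> Ext) (g : V -> C) x :
    (forall k, form_derivable k w x) -> (forall k, cderivable k g x) ->
    homogeneous 1 (w x) ->
  dext (fun y => w y * (g y)%:A) x =
  dext w x * (g x)%:A - w x * dext (fun y => (g y)%:A) x.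
Proof.
move=> dw dg w1; rewrite dext_scalar !dext_coframe mulr_suml mulr_sumr -sumrB.
rewrite (_ : (fun y => _) = (fun y => g y *: w y)); last first.
  by apply/funext => y; rewrite mulr_algr.
apply: eq_bigr => k _; rewrite (form_partialZ (dg k) (dw k)).2 mulrDr addrC.
rewrite -!scalerAr mulr1; congr (_ + _).
by rewrite (ext_anticommute (@real_coframe_homogeneous k) w1) scalerN.
Qed.

Lemma dextD (w w' : V -> Ext) x : (forall k, form_derivable k w x) ->
  (forall k, form_derivable k w' x) ->
  dext (fun y => w y + w' y) x = dext w x + dext w' x.
Proof.
move=> dw dw'; rewrite !dext_coframe -big_split; apply: eq_bigr => k _.
by rewrite (form_partialD (dw k) (dw' k)).2 mulrDr.
Qed.

Lemma dext_sum (I : finType) (W : I -> V -> Ext) x :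
  (forall i k, form_derivable k (W i) x) ->
  dext (fun y => \sum_i W i y) x = \sum_i dext (W i) x.
Proof.
move=> dW; rewrite dext_coframe.
under [RHS]eq_bigr => i _ do rewrite dext_coframe.
rewrite exchange_big; apply: eq_bigr => k _.
by rewrite (form_partial_sum _ (fun i => dW i k)).2 mulr_sumr.
Qed.

Local Notation sext := (scalar_mx_ext (n + n)).

(** In nabla (dG + Th G) the terms Th dG cancel by Leibniz' rule, and d (dG) = 0;
   no derivative of G is left. *)
Lemma curvature_commutes_with_scalars r q (W : set V)
    (Th : V -> 'M[Ext]_r) (G : V -> 'M[C]_(r, q)) x :
    nbhs x W -> (forall i j, smooth_on W (fun y => G y i j)) ->
    (forall i j S, smooth_on W (fun y => Th y i j S)) ->
    (forall i j, homogeneous 1 (Th x i j)) ->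
  let nab (w : V -> 'M[Ext]_(r, q)) y := dmx w y + Th y *m w y in
  nab (nab (fun y => sext (G y))) x = (dmx Th x + Th x *m Th x) *m sext (G x).
Proof.
move=> nW sG sT T1 nab; have Wx := nbhs_singleton nW.
have dG i j k : cderivable k (fun y => G y i j) x := smooth_cderivable k (sG i j) Wx.
have dT i j k : form_derivable k (fun y => Th y i j) x.
  by move=> S; apply: smooth_cderivable (sT i j S) Wx.
have sE y i j : sext (G y) i j = (G y i j)%:A by rewrite mxE.
have dprod i j k l : form_derivable k (fun y => Th y i l * (G y l j)%:A) x.
  rewrite (_ : (fun y => _) = (fun y => G y l j *: Th y i l)); last first.
    by apply/funext => y; rewrite mulr_algr.
  exact: (form_partialZ (dG l j k) (dT i l k)).1.
rewrite [in LHS]/nab mulmxDr addrA mulmxDl mulmxA; congr (_ + _).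
apply/matrixP => i j; rewrite !mxE.
have -> : (fun y => (dmx (fun z => sext (G z)) y + Th y *m sext (G y)) i j) =
    (fun y => dext (fun z => (G z i j)%:A) y + \sum_l Th y i l * (G y l j)%:A).
  apply/funext => y; rewrite mxE [dmx _ _ _ _]mxE [(_ *m _) _ _]mxE.
  under eq_bigr => l _ do rewrite sE.
  rewrite (_ : (fun z => sext (G z) i j) = (fun z => (G z i j)%:A)) //.
  by apply/funext => z; rewrite sE.
rewrite dextD; first last.
- by move=> k; apply: (form_partial_sum _ (fun l => dprod i j k l)).1.
- by move=> k; apply: (dext_scalar_derivable k (sG i j) Wx).1.
rewrite (dext_dext_scalar nW (sG i j)) add0r dext_sum; last first.
  by move=> l k; apply: dprod.
rewrite -big_split; apply: eq_bigr => l _ /=.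
rewrite (dext_mul_scalar (dT i l) (dG l j) (T1 i l)) sE.
rewrite [dmx _ _ _ _]mxE [dmx _ _ _ _]mxE.
have -> : (fun y => sext (G y) l j) = (fun y => (G y l j)%:A).
  by apply/funext => z; rewrite sE.
exact: subrK.
Qed.

Lemma smooth_cst (W : set V) (c : C) : smooth_on W (fun=> c).
Proof.
have H (a : R) : rsmooth_on W (fun=> a).
  move=> s x Wx; have [b ->] : exists b, rpartials s (fun=> a) = fun=> b.
    elim: s => [|k s [b /= ->]]; first by exists a.
    by exists 0; apply/funext => y; rewrite /rpartial derive_cst.
  by split; [exact: cst_continuous | move=> k; exact: derivable_cst].
by split; apply: H.
Qed.

End PartialDerivatives.

(** * Curvature under a change of frame *)

Section FrameChange.
Variables (R : realType) (n : nat) (M : complexManifold R n) (r : nat).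
Variables (E : holoBundle M r) (h : hermitianMetric E) (D : connection E).
Local Notation C := R[i].
Local Notation V := 'rV[R]_(n + n).
Local Notation Ext := (ext C (n + n)).
Local Notation sext := (scalar_mx_ext (n + n)).

(** Within the open range of the chart, the set is the preimage of U by the
   inverse of the chart. *)
Lemma cimg_nbhs (a : chart M) (U : set M) x : open U -> cimg a U x ->
  nbhs x (cimg a U).
Proof.
move=> oU [p [Up ap] px].
have xran : (cmap a @` cdom a) x by exists p.
have xinv : cinv a x = p by rewrite -px cmapK.
have n1 : nbhs x (cmap a @` cdom a) by apply: open_nbhs_nbhs; split=> //; apply: cran_open.
have n2 : nbhs x (cinv a @^-1` U).
  apply: (cinv_continuous xran); apply: open_nbhs_nbhs; split=> //.
  by rewrite xinv.
apply: (filterS _ (filterI n1 n2)) => y [[q aq qy] Uy].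
by exists q => //; split=> //; move: Uy; rewrite /preimage /= -qy cmapK.
Qed.

Lemma curvature_holomorphic_frame (b : triv E) (a : chart M) x :
  cimg a (tdom b) x ->
  curvature_matrix D b (fun=> 1%:M) a x =
  dmx (cform D b a) x + cform D b a x *m cform D b a x.
Proof.
move=> xb.
have H : nabla D b a (nabla D b a (fun=> sext 1%:M)) x =
    (dmx (cform D b a) x + cform D b a x *m cform D b a x) *m sext 1%:M.
  apply: (@curvature_commutes_with_scalars R n r r (cimg a (tdom b))
    (cform D b a) (fun=> 1%:M) x (cimg_nbhs (tdom_open b) xb)).
  - by move=> i j; apply: smooth_cst.
  - by move=> i j S; apply: cform_smooth.
  - by move=> i j; apply: cform_degree.
rewrite /curvature_matrix H invmx1.
by rewrite /scalar_mx_ext map_mx1 mul1mx mulmx1.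
Qed.

(** The components G of the unitary frame are invertible because
   G^T H conj(G) = 1. *)
Lemma curvature_frame_change (U : set M) (G : triv E -> M -> 'M[C]_r)
    (b : triv E) (a : chart M) x :
  open U -> unitary_frame h U G -> cimg a (U `&` tdom b) x ->
  exists P Q : 'M[C]_r, P *m Q = 1%:M /\
    curvature_matrix D b (fun=> 1%:M) a x =
    sext P *m curvature_matrix D b (G b) a x *m sext Q.
Proof.
move=> oU [sG _ uG] xU; pose g := G b (cinv a x).
have nW := cimg_nbhs (openI oU (tdom_open b)) xU.
have xb : cimg a (tdom b) x.
  by have [p [[Up bp] ap] px] := xU; exists p.
have gU : g \in unitmx.
  have [p [[Up bp] ap] px] := xU.
  have := uG b p Up bp; rewrite -mulmxA => /mulmx1_unit[+ _].
  by rewrite unitmx_tr /g -px cmapK.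
exists g, (invmx g); split; first exact: mulmxV.
have H : nabla D b a (nabla D b a (fun y => sext (G b (cinv a y)))) x =
    (dmx (cform D b a) x + cform D b a x *m cform D b a x) *m sext g.
  apply: (@curvature_commutes_with_scalars R n r r (cimg a (U `&` tdom b))
    (cform D b a) (fun y => G b (cinv a y)) x nW).
  - by move=> i j; apply: sG.
  - move=> i j S; have [rs is_] := cform_smooth D b a i j S.
    have sub y : cimg a (U `&` tdom b) y -> cimg a (tdom b) y.
      by move=> [p [[Up bp] ap] py]; exists p.
    by split=> s y /sub Wy; [apply: rs | apply: is_].
  - by move=> i j; apply: cform_degree.
rewrite (curvature_holomorphic_frame xb) /curvature_matrix H.
have e : sext g *m sext (invmx g) = 1%:M.
  by rewrite /scalar_mx_ext -(map_mxM (in_alg Ext)) mulmxV // map_mx1.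
rewrite -/g; move: (_ + _) => X.
by rewrite -!mulmxA e mulmx1 mulmxA e mul1mx.
Qed.

End FrameChange.

(** * Chern forms at a point *)

(** The characteristic polynomial is invariant under conjugation. *)
Lemma elementary_conj (K : comNzRingType) r (P Q W : 'M[K]_r) z :
  P *m Q = 1%:M -> elementary (P *m W *m Q) z = elementary W z.
Proof.
move=> PQ; case: z => // m; rewrite /elementary; case: ifP => // _.
have PQ' : map_mx polyC P *m map_mx polyC Q = 1%:M by rewrite -map_mxM PQ map_mx1.
have -> : 'X%:M + map_mx polyC (P *m W *m Q) =
    map_mx polyC P *m ('X%:M + map_mx polyC W) *m map_mx polyC Q.
  rewrite mulmxDr mulmxDl !map_mxM scalar_mxC.
  by rewrite -[X in _ = X + _]mulmxA PQ' mulmx1.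
by rewrite !det_mulmx mulrAC -det_mulmx PQ' det1 mul1r.
Qed.

Lemma det_mx2 (K : comNzRingType) (X : 'M[K]_2) :
  \det X = X ord0 ord0 * X ord_max ord_max - X ord0 ord_max * X ord_max ord0.
Proof.
rewrite (expand_det_row _ ord0) !big_ord_recl big_ord0 addr0 /cofactor !det_mx11.
rewrite !mxE /= expr0 expr1 mul1r mulN1r mulrN.
by congr (X _ _ * X _ _ - X _ _ * X _ _); apply: val_inj.
Qed.

Section Pointwise.
Variables (R : realType) (n : nat) (M : complexManifold R n) (r : nat).
Variables (E : holoBundle M r) (h : hermitianMetric E) (D : connection E).
Local Notation C := R[i].
Local Notation Ext := (ext C (n + n)).
Local Notation Ev := (even_ext C (n + n)).
Local Notation sext := (scalar_mx_ext (n + n)).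

Lemma chern_form_elementary (W : 'M[Ev]_r) (b : triv E) (a : chart M) x (m : int) :
  (forall i j, even_val (W i j) =
     (0 +i* (2 * pi)^-1)%C *: curvature_matrix D b (fun=> 1%:M) a x i j) ->
  chern_form D m b a x = even_val (elementary W m).
Proof.
move=> hW; case: m => // k; rewrite /chern_form /elementary.
case: ifP => _; last by rewrite rmorph0.
set X := (X in \det X).
have -> : X = map_mx (map_poly (@even_val C (n + n))) ('X%:M + map_mx polyC W).
  rewrite map_mxD map_scalar_mx /= map_polyX -map_mx_comp; congr (_ + _).
  by apply/matrixP => i j; rewrite mxE -hW [RHS]mxE /= map_polyC.
by rewrite det_map_mx coef_map.
Qed.

(** W is 1/(2 pi) i times the curvature matrix in the unitary frame, with entries
   in the ring of even forms; the scalar matrices P and Q, which go over to the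
   holomorphic frame, do not change the Chern forms. *)
Lemma pointwise_positivity (b : triv E) (a : chart M) x :
  bott_chern_nonnegative h D -> cimg a (tdom b) x ->
  exists W : 'M[Ev]_r,
    (forall m, chern_form D m b a x = even_val (elementary W m)) /\
    (forall l k (la : 'I_l -> nat),
       (forall i j : 'I_l, (i <= j)%N -> (la j <= la i)%N) ->
       (\sum_j la j)%N = k ->
       strongly_nonnegative k (even_val (\det (\matrix_(j < l, j' < l)
         elementary W ((la j)%:Z - j%:Z + j'%:Z))))).
Proof.
move=> hBC [p [bp ap] px].
have [U [G [s [A [[oU Up] uG _ A10 OmA]]]]] := hBC p.
have xUb : cimg a (U `&` tdom b) x by exists p.
have xU : cimg a U x by exists p.
have [P [Q [PQ OmE]]] := curvature_frame_change D oU uG xUb.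
have {}A10 : forall i j, of_type 1 0 (A a x i j) by move=> i j; apply: A10.
rewrite OmA // in OmE.
pose c : C := (0 +i* (2 * pi)^-1)%C.
pose om i j : Ext := \sum_t A a x i t * conj_ext (A a x j t).
have om_even i j : c *: om i j \in @even_form C (n + n).
  apply: even_form_scale; apply: rpred_sum => t _; apply: even_formM_odd.
    exact: (of_type_homogeneous (A10 i t)).
  exact: (of_type_homogeneous (of_type_conj (A10 j t))).
have sc_even (t : C) : t%:A \in @even_form C (n + n).
  by apply: even_form_scale; apply: rpred1.
have [W WE] : exists W : 'M[Ev]_r, forall i j, even_val (W i j) = c *: om i j.
  by exists (\matrix_(i, j) EvenExt (om_even i j)) => i j; rewrite mxE.
have [sc scE] : exists sc : 'M[C]_r -> 'M[Ev]_r,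
    forall X i j, even_val (sc X i j) = (X i j)%:A.
  exists (fun X => \matrix_(i, j) EvenExt (sc_even (X i j))) => X i j.
  by rewrite mxE.
have scPQ : sc P *m sc Q = 1%:M.
  apply/matrixP => i j; apply: val_inj.
  rewrite -[LHS]/(even_val _) -[RHS]/(even_val _).
  rewrite mxE rmorph_sum [in RHS]mxE rmorph_nat.
  have /matrixP/(_ i j) := PQ; rewrite [RHS]mxE mxE => PQij.
  rewrite -[RHS](scaler_nat _ (1 : Ext)) -PQij scaler_suml; apply: eq_bigr => t _.
  by rewrite rmorphM /= !scE mulr_algr scalerA mulrC.
exists W; split=> [m|l k la la_sorted la_sum].
  rewrite -(elementary_conj W m scPQ); apply: chern_form_elementary => i j.
  rewrite OmE [in LHS]mxE rmorph_sum [in RHS]mxE scaler_sumr; apply: eq_bigr => u _.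
  rewrite rmorphM /= scE scalerAl [sext Q _ _]mxE; congr (_ * _).
  rewrite [in LHS]mxE rmorph_sum [in RHS]mxE scaler_sumr; apply: eq_bigr => t _.
  rewrite rmorphM /= scE scalerAr [sext P _ _]mxE; congr (_ * _).
  rewrite WE [in RHS]mxE; congr (_ *: _).
  by apply: eq_bigr => v _; rewrite !mxE.
have kf : k`!%:R != 0 :> C by rewrite pnatr_eq0 -lt0n fact_gt0.
set d := \det _; have dE := @schur_determinant Ev r W l k la la_sum.
rewrite -/d in dE.
have -> : even_val d = (k`!%:R)^-1 *: even_val (k`!%:R * d).
  rewrite rmorphM rmorph_nat mulr_natl -(scaler_nat _ (even_val d)) scalerA.
  by rewrite mulVf // scale1r.
rewrite dE rmorph_sum.
have d0 : 0 <= (2 * pi)^-1 :> R by rewrite invr_ge0 mulr_ge0 // pi_ge0.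
have := schur_expansion_strongly_nonnegative A10 la_sorted la_sum d0.
congr (strongly_nonnegative _ (_ *: _)); apply: eq_bigr => g _.
rewrite !rmorphM rmorph_sign rmorph_int; congr (_ * _).
rewrite rmorph_sum; apply: eq_bigr => i _; rewrite rmorph_prod.
by apply: eq_bigr => q _; rewrite /= WE.
Qed.

End Pointwise.

Theorem proposition3p1 (R : realType) (n r : nat) (M : complexManifold R n)
    (Mcompact : compact [set: M]) (E : holoBundle M r)
    (h : hermitianMetric E) (D : connection E)
    (Dchern : chern_connection h D)
    (hBC : bott_chern_nonnegative h D) :
  [/\ forall (i : nat) (la : i.-tuple nat), (1 <= i <= n)%N -> Gamma r la ->
        forall b : triv E,
          strongly_nonnegative_on (tdom b) i (schur_form D la b),
      forall i : nat, (1 <= i <= n)%N ->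
        forall b : triv E,
          strongly_nonnegative_on (tdom b) i (chern_form D i%:Z b)
    & forall i j : nat, (1 <= i <= n)%N -> (1 <= j <= i %/ 2)%N ->
        forall b : triv E,
          strongly_nonnegative_on (tdom b) i (fun a x =>
            chern_form D (i%:Z - j%:Z) b a x * chern_form D j%:Z b a x -
            chern_form D (i%:Z - j%:Z + 1) b a x *
              chern_form D (j%:Z - 1) b a x) ].
Proof.
split=> [i la _ [_ la_sorted la_sum] b a x xb|i _ b a x xb|i j _ /andP[j0 ji] b a x xb];
  have [W [cE pos]] := pointwise_positivity hBC xb.
- have := pos i i (tnth la).
  rewrite /schur_form -det_map_mx (_ : map_mx _ _ = \matrix_(p < i, q < i)
    chern_form D ((tnth la p)%:Z - p%:Z + q%:Z) b a x); last first.
    by apply/matrixP => p q; rewrite !mxE cE.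
  have geq_trans : transitive geq by move=> u v w /= vu uw; apply: leq_trans uw vu.
  apply=> [p q pq|].
    rewrite !(tnth_nth 0%N); apply: (sorted_leq_nth geq_trans _ _ la_sorted) => //.
    - by move=> u /=.
    - by rewrite inE size_tuple.
    - by rewrite inE size_tuple.
  by rewrite -[RHS]la_sum sumnE big_tuple.
- have := pos 1%N i (fun=> i); rewrite det_mx11 mxE -cE subr0 addr0; apply=> //.
  by rewrite big_ord1.
have ij : (j + j <= i)%N by lia.
have := pos 2%N i (fun p => if p == ord0 then i - j else j)%N.
rewrite det_mx2 rmorphB !rmorphM !mxE !cE.
rewrite eqxx (_ : (ord_max == ord0 :> 'I_2) = false) //.
rewrite (_ : @nat_of_ord 2 ord0 = 0%N) // (_ : @nat_of_ord 2 ord_max = 1%N) //.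
rewrite subr0 !addr0 subrK.
rewrite -subzn; last by lia.
apply=> [p q pq|]; last by rewrite !big_ord_recl big_ord0 /=; lia.
case: (eqVneq p ord0) => [_|np]; first by case: ifP => _ //; lia.
rewrite ifN //; apply: contra np => /eqP q0; rewrite q0 leqn0 in pq.
by apply/eqP/val_inj/eqP.
Qed.
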